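(* Let $k\ge 1$ be an integer and let $\{G_i=(\Omega_i,u_i)\}_{i=1}^k$ be a set of disjointly supported minimal graphs in $\mathbb{R}^3$, where each $\Omega_i$ is an open subset of $\mathbb{R}^2$. If each graph $G_i$ has sub-linear growth, then $k\le 2$.
   Context: Let $\Omega\subset\mathbb{R}^2$ be a (nonempty) open set with boundary $\partial\Omega$. If a function $u$ on $\Omega$ satisfies the minimal surface equation $\operatorname{div}\left(\frac{\nabla u}{\sqrt{1+|\nabla u|^2}}\right)=0$ on $\Omega$, then $G=\{(x,u(x)) : x\in\Omega\}$ is called a minimal graph in $\mathbb{R}^3$, written $G=(\Omega,u)$. Here $u$ is understood to be $C^2$ in $\Omega$ and continuous up to $\partial\Omega$. The minimal graph $G$ is said to be supported on $\Omega$ if $u|_{\partial\Omega}=0$, $u\ge 0$, and $u$ is not identically zero. A set $\{G_i=(\Omega_i,u_i)\}_{i=1}^k$ of minimal graphs is disjointly supported if each $G_i$ is supported on $\Omega_i$ and the open sets $\Omega_1,\dots,\Omega_k$ are pairwise disjoint. The graph $G=(\Omega,u)$ has sub-linear growth if $u(x)/|x|\to 0$ as $|x|\to\infty$ with $x\in\Omega$. *)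

(* Defs.v *)
From mathcomp Require Import all_boot all_order all_algebra.
From mathcomp Require Import all_classical all_reals all_analysis.
Import Order.TTheory GRing.Theory Num.Theory.
Import numFieldNormedType.Exports.

Set Implicit Arguments.
Unset Strict Implicit.
Unset Printing Implicit Defensive.

Local Open Scope classical_set_scope.
Local Open Scope ring_scope.

(* The canonical norm on [R * R] is the max norm, hence a separate Euclidean
   norm; the topology, and so every use of [open], [closure] and [continuous]
   below, is the usual one. *)
Definition enorm (R : realType) (p : R * R) : R :=
  Num.sqrt (p.1 ^+ 2 + p.2 ^+ 2).

Definition partial1 (R : realType) (f : R * R -> R) : R * R -> R :=
  'D_((1, 0) : R * R) f.

Definition partial2 (R : realType) (f : R * R -> R) : R * R -> R :=
  'D_((0, 1) : R * R) f.

Definition grad (R : realType) (f : R * R -> R) (p : R * R) : R * R :=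
  (partial1 f p, partial2 f p).

Definition divergence (R : realType) (F : R * R -> R * R) (p : R * R) : R :=
  partial1 (fun q => (F q).1) p + partial2 (fun q => (F q).2) p.

(* ['D_v f p] has a default value where the derivative does not exist, so the
   existence of the partial derivatives is required explicitly. *)
Definition C1_on (R : realType) (Omega : set (R * R)) (f : R * R -> R) : Prop :=
  forall p, Omega p ->
    [/\ derivable f p ((1, 0) : R * R), derivable f p ((0, 1) : R * R),
        {for p, continuous (partial1 f)} & {for p, continuous (partial2 f)}].

Definition C2_on (R : realType) (Omega : set (R * R)) (f : R * R -> R) : Prop :=
  [/\ C1_on Omega f, C1_on Omega (partial1 f) & C1_on Omega (partial2 f)].

Definition minimal_surface_equation (R : realType) (Omega : set (R * R))
    (u : R * R -> R) : Prop :=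
  forall p, Omega p ->
    divergence
      (fun q => (Num.sqrt (1 + enorm (grad u q) ^+ 2))^-1 *: grad u q) p = 0.

Definition boundary (T : topologicalType) (A : set T) : set T :=
  closure A `\` interior A.

(* [u] is a total function, but only its values on [closure Omega] matter. *)
Definition minimal_graph (R : realType) (Omega : set (R * R))
    (u : R * R -> R) : Prop :=
  [/\ open Omega, Omega !=set0, C2_on Omega u,
      {within closure Omega, continuous u} & minimal_surface_equation Omega u].

Definition supported (R : realType) (Omega : set (R * R))
    (u : R * R -> R) : Prop :=
  [/\ forall p, boundary Omega p -> u p = 0,
      forall p, Omega p -> 0 <= u p
    & exists2 p, Omega p & u p != 0].

Definition disjointly_supported (R : realType) (k : nat)
    (Omega : 'I_k -> set (R * R)) (u : 'I_k -> R * R -> R) : Prop :=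
  (forall i, minimal_graph (Omega i) (u i) /\ supported (Omega i) (u i)) /\
  trivIset [set: 'I_k] Omega.

Definition at_infinity (R : realType) : set_system (R * R) :=
  filter_from [set: R] (fun M => [set p | M < enorm p]).

Definition sublinear_growth (R : realType) (Omega : set (R * R))
    (u : R * R -> R) : Prop :=
  u p / enorm p @[p --> within Omega (@at_infinity R)] --> (0 : R).

(* Main.v *)
Require Import Defs.
From mathcomp Require Import all_boot all_order all_algebra.
From mathcomp Require Import all_classical all_reals all_analysis.
From mathcomp Require Import ring lra.
Import Order.TTheory GRing.Theory Num.Theory.
Import numFieldNormedType.Exports.

Set Implicit Arguments.
Unset Strict Implicit.
Unset Printing Implicit Defensive.

Local Open Scope classical_set_scope.
Local Open Scope ring_scope.

(** Three disjointly supported graphs of sublinear growth cannot coexist: the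
    fluxes that they send through the boundary of a large square would have
    to grow, in geometric mean, faster than quadratically, whereas sublinear
    growth keeps each of them below quadratic.

    Put W = sqrt (1 + |grad u|^2). By the minimal surface equation grad u / W
    is divergence free on Omega. Let g be a nondecreasing C^1 truncation that
    vanishes below a positive level. The set where u is at least that level is
    closed in the plane, because u is continuous up to the boundary and
    vanishes there; so V = g(u) grad u / W, extended by zero, is a continuous
    field on the plane with divergence g'(u) |grad u|^2 / W >= 0. Let Phi(r) be
    the flux of V through the boundary of the square max(|x|, |y|) <= r. Then:

    - Phi'(r) is the integral of g'(u) |grad u|^2 / W along that boundary
      ([flux_is_derive]);
    - Phi(r) <= 8 r sup u = o(r^2), the supremum being over that boundary,
      since |grad u| / W <= 1 ([flux_bound], [graph_flow_bound]);
    - Phi(r) <= (S(r) / (2 c)) Phi'(r), where S(r) is the integral of W over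
      the part of the boundary where u is not small ([flux_growth]). Indeed
      W dt is the parameter in which the tangential part of the energy becomes
      the plain Dirichlet integral of a function on an interval of length S(r).
      That function vanishes at the ends: the boundary of the square also meets
      the support of another graph, and there it can be cut open. The
      one-dimensional Poincare inequality ([loop_poincare]) and the
      Cauchy-Schwarz inequality give the claim, for any c with c^2 <= 8.

    The lengths S compete for room. Since W <= 1 + |grad u|^2 / W and the
    supports are disjoint, the sum of the S(r) is at most 8 r + Psi'(r), where
    Psi is the sum of the fluxes for a lower truncation level, and Psi = o(r^2)
    as well. If there are three graphs, then by convexity of 1/S the sum of the
    Phi'/Phi is at least (2 c) 9 / (8 r), up to an error whose integral is a
    small multiple of log r; with c = 14/5 the product of the three fluxes
    grows like r^6.3 up to a small loss in the exponent, which is incompatible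
    with o(r^6) ([no_three_growing]).

    Squares replace discs because their sides are parallel to the axes: only
    partial derivatives and integrals of one variable then occur. The longer
    perimeter costs a factor 4 / pi in the exponent, and the elementary
    constant sqrt 8 replaces pi in the Poincare inequality; three graphs still
    leave room for both losses. *)

(** * Integrals of continuous functions as increments of primitives *)

Section calculus.
Context {R : realType}.
Implicit Types (f g P : R -> R) (a b x : R).

Lemma is_derive_const (V : normedModType R) (k : R) (p v : V) :
  is_derive p v (fun=> k) (0 : R).
Proof. exact: is_derive_cst. Qed.

Lemma is_derive_add (V : normedModType R) (f g : V -> R) (p v : V) (a b : R) :
  is_derive p v f a -> is_derive p v g b ->
  is_derive p v (fun q => f q + g q) (a + b).
Proof. exact: is_deriveD. Qed.

Lemma is_derive_sub (V : normedModType R) (f g : V -> R) (p v : V) (a b : R) :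
  is_derive p v f a -> is_derive p v g b ->
  is_derive p v (fun q => f q - g q) (a - b).
Proof. exact: is_deriveB. Qed.

Lemma is_derive_opp (V : normedModType R) (f : V -> R) (p v : V) (a : R) :
  is_derive p v f a -> is_derive p v (fun q => - f q) (- a).
Proof. exact: is_deriveN. Qed.

Lemma is_derive_mul (V : normedModType R) (f g : V -> R) (p v : V) (a b : R) :
  is_derive p v f a -> is_derive p v g b ->
  is_derive p v (fun q => f q * g q) (f p * b + g p * a).
Proof. exact: is_deriveM. Qed.

Lemma is_derive_scale (V : normedModType R) (f : V -> R) (p v : V) (a k : R) :
  is_derive p v f a -> is_derive p v (fun q => k * f q) (k * a).
Proof. exact: is_deriveZ. Qed.

Lemma is_derive_continuous f x a : is_derive x 1 f a -> {for x, continuous f}.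
Proof. by move=> [/derivable1_diffP/differentiable_continuous]. Qed.

Lemma le_of_is_derive f (df : R -> R) a b : a <= b ->
  (forall x, a <= x <= b -> is_derive x 1 f (df x)) ->
  (forall x, a <= x <= b -> 0 <= df x) -> f a <= f b.
Proof.
move=> ab fdf df0.
have [x||c cab E] := @MVT_segment _ f df a b ab.
- by rewrite in_itv /= => /andP[/ltW ax /ltW xb]; apply: fdf; rewrite ax.
- apply: continuous_in_subspaceT => x; rewrite inE /= in_itv /= => xab.
  exact: is_derive_continuous (fdf _ xab).
- by rewrite -subr_ge0 E mulr_ge0 ?subr_ge0 // df0.
Qed.

Lemma eq_of_is_derive f g (df : R -> R) a b : a <= b ->
  (forall x, a <= x <= b -> is_derive x 1 f (df x)) ->
  (forall x, a <= x <= b -> is_derive x 1 g (df x)) ->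
  f b - f a = g b - g a.
Proof.
move=> ab fdf gdf.
have H (h : R -> R) : (forall x, a <= x <= b -> is_derive x 1 h 0) -> h a <= h b.
  by move=> hd; apply: (@le_of_is_derive _ (fun=> 0)).
have : f a - g a <= f b - g b.
  by apply: (H (fun x => f x - g x)) => x xab; rewrite -(subrr (df x));
    apply: is_derive_sub; [exact: fdf|exact: gdf].
have : g a - f a <= g b - f b.
  by apply: (H (fun x => g x - f x)) => x xab; rewrite -(subrr (df x));
    apply: is_derive_sub; [exact: gdf|exact: fdf].
by lra.
Qed.

(** On each half-line ]-N, +oo[ the fundamental theorem of calculus provides a
    primitive; normalized to vanish at 0, these primitives agree where they
    overlap, so they glue together. *)
Lemma primitive_exists f : continuous f ->
  exists P, forall x, is_derive x 1 P (f x).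
Proof.
move=> cf; pose Q (N x : R) := \int[lebesgue_measure]_(t in `[- N, x]) f t.
have dQ N x : - N < x -> is_derive x 1 (Q N) (f x).
  move=> Nx.
  have xx1 : x < x + 1 by rewrite ltrDl.
  have [|dP <-] := @continuous_FTC1_closed R f (- N) x (x + 1) xx1 _ Nx (cf x).
    apply: continuous_compact_integrable; first exact: segment_compact.
    exact: continuous_subspaceT.
  by rewrite derive1E; apply: derivableP.
have QE N M y : `|y| < N -> `|y| < M -> Q N y - Q N 0 = Q M y - Q M 0.
  rewrite !ltr_norml => /andP[yN1 yN2] /andP[yM1 yM2].
  have [y0|/ltW y0] := leP 0 y.
    by apply: (@eq_of_is_derive _ _ f) => // x /andP[x0 xy]; apply: dQ; lra.
  suff : Q N 0 - Q N y = Q M 0 - Q M y by lra.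
  by apply: (@eq_of_is_derive _ _ f) => // x /andP[x0 xy]; apply: dQ; lra.
exists (fun y => Q (`|y| + 1) y - Q (`|y| + 1) 0) => x.
apply: (@near_eq_is_derive _ _ _ (fun y => Q (`|x| + 1) y - Q (`|x| + 1) 0)).
  near=> y; apply: QE; last by rewrite ltrDl.
  near: y; apply: (@cvgr_lt _ _ _ _ (fun y : R => `|y|) `|x|).
    exact: (@norm_continuous _ R).
  by rewrite ltrDl.
rewrite -[f x]subr0; apply: (@is_derive_sub _ (Q (`|x| + 1))
  (fun=> Q (`|x| + 1) 0)).
by apply: dQ; have := lerNnormlW (lexx `|x|); lra.
Unshelve. all: by end_near. Qed.

(** Choosing one primitive for each continuous function makes the integral
    [pint] additive in its bounds by definition, for bounds in any order, and
    reduces monotonicity and linearity to the mean value theorem. *)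
Definition prim f : R -> R :=
  xget (fun=> 0) [set P | forall x, is_derive x 1 P (f x)].

Definition pint f a b : R := prim f b - prim f a.

Lemma prim_is_derive f : continuous f -> forall x, is_derive x 1 (prim f) (f x).
Proof. move=> cf; exact: (xgetPex (fun=> 0) (primitive_exists cf)). Qed.

Lemma pint_primitive f P a b : a <= b -> continuous f ->
  (forall x, a <= x <= b -> is_derive x 1 P (f x)) -> pint f a b = P b - P a.
Proof.
move=> ab cf fP; apply: (@eq_of_is_derive _ _ f) => // x _.
exact: prim_is_derive.
Qed.

Lemma pint_primitive_global f P a b : continuous f ->
  (forall x, is_derive x 1 P (f x)) -> pint f a b = P b - P a.
Proof.
move=> cf fP; have [ab|/ltW ba] := leP a b; first exact: pint_primitive.
by rewrite -[LHS]opprB -[RHS]opprB; congr (- _); apply: pint_primitive.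
Qed.

Lemma le_pint f g a b : a <= b -> continuous f -> continuous g ->
  (forall x, a <= x <= b -> f x <= g x) -> pint f a b <= pint g a b.
Proof.
move=> ab cf cg fg; rewrite /pint -subr_ge0.
rewrite [X in 0 <= X](_ : _ = (prim g b - prim f b) - (prim g a - prim f a)); last by lra.
rewrite subr_ge0; apply: (@le_of_is_derive (fun x => prim g x - prim f x)
  (fun x => g x - f x)) => // x xab; last by rewrite subr_ge0 fg.
by apply: is_derive_sub; exact: prim_is_derive.
Qed.

Lemma eq_pint f g a b : f =1 g -> pint f a b = pint g a b.
Proof. by move=> /funext ->. Qed.

Lemma pint_cst (k : R) a b : a <= b -> pint (fun=> k) a b = k * (b - a).
Proof.
move=> ab; rewrite mulrBr; apply: (@pint_primitive _ (fun x => k * x)) => //.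
  exact: cst_continuous.
by move=> x _; rewrite -{2}[k]mulr1; apply: is_derive_scale.
Qed.

Lemma pintD f g a b : a <= b -> continuous f -> continuous g ->
  pint (fun x => f x + g x) a b = pint f a b + pint g a b.
Proof.
move=> ab cf cg; rewrite /pint addrACA -opprD.
apply: (@pint_primitive _ (fun x => prim f x + prim g x)) => //.
- by move=> x; apply: cvgD; [exact: cf|exact: cg].
- by move=> x _; apply: is_derive_add; exact: prim_is_derive.
Qed.

Lemma pintZ f (k : R) a b : a <= b -> continuous f ->
  pint (fun x => k * f x) a b = k * pint f a b.
Proof.
move=> ab cf; rewrite /pint mulrBr.
apply: (@pint_primitive _ (fun x => k * prim f x)) => //.
- by move=> x; apply: cvgM; [exact: cvg_cst|exact: cf].
- by move=> x _; apply: is_derive_scale; exact: prim_is_derive.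
Qed.

Lemma pint_ge0 f a b : a <= b -> continuous f ->
  (forall x, a <= x <= b -> 0 <= f x) -> 0 <= pint f a b.
Proof.
move=> ab cf f0; have := @pint_cst 0 a b ab; rewrite mul0r => <-.
by apply: le_pint => //; exact: cst_continuous.
Qed.

Lemma le_norm_pint f (k : R) a b : a <= b -> continuous f ->
  (forall x, a <= x <= b -> `|f x| <= k) -> `|pint f a b| <= k * (b - a).
Proof.
move=> ab cf fk; rewrite ler_norml -mulNr -!pint_cst //.
by apply/andP; split; apply: le_pint => //; (try exact: cst_continuous) => x /fk;
  rewrite ler_norml => /andP[].
Qed.

End calculus.

(** * Differentiating an integral over an expanding side *)

Section leibniz.
Context {R : realType}.
Implicit Types (F : R * R -> R).

(** A directional derivative only sees the restriction of the function to a
    line, so it can be transported to any parametrization of that line. *)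
Lemma is_derive_line (V W : normedModType R)
    (F : V -> R) (G : W -> R) (p v : V) (q w : W) (l : R) :
  (forall h : R, F (h *: v + p) = G (h *: w + q)) ->
  is_derive p v F l -> is_derive q w G l.
Proof.
move=> FG [dF vF]; have E : (fun h : R => h^-1 *: ((F \o shift p) (h *: v) - F p)) =
    (fun h : R => h^-1 *: ((G \o shift q) (h *: w) - G q)).
  apply/funext => h; have := FG 0; rewrite !scale0r !add0r /= => <-.
  by rewrite FG.
by split; move: dF vF; rewrite /derivable /derive E.
Qed.

Lemma is_derive_horizontal F (x y l : R) :
  is_derive (x, y) ((1, 0) : R * R) F l <->
  is_derive x 1 (fun t => F (t, y)) l.
Proof.
have E (h : R) : F (h *: ((1, 0) : R * R) + (x, y)) = F (h *: (1 : R) + x, y).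
  by congr F; apply/pair_equal_spec; rewrite /= [h *: 0]mulr0 add0r.
by split; apply: is_derive_line.
Qed.

Lemma is_derive_vertical F (x y l : R) :
  is_derive (x, y) ((0, 1) : R * R) F l <->
  is_derive y 1 (fun t => F (x, t)) l.
Proof.
have E (h : R) : F (h *: ((0, 1) : R * R) + (x, y)) = F (x, h *: (1 : R) + y).
  by congr F; apply/pair_equal_spec; rewrite /= [h *: 0]mulr0 add0r.
by split; apply: is_derive_line.
Qed.

Lemma continuous_pair (T U : topologicalType) (f g : T -> R) (F : R * R -> U) :
  continuous f -> continuous g -> continuous F ->
  continuous (fun t => F (f t, g t)).
Proof.
move=> cf cg cF t.
apply: (@continuous_comp _ _ _ (fun t => (f t, g t)) F); last exact: cF.
exact: (cvg_pair (cf t) (cg t)).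
Qed.

Lemma is_derive_eps (f : R -> R) (x l : R) :
  (forall e, 0 < e -> exists2 d, 0 < d &
    forall h, `|h| < d -> `|f (x + h) - f x - h * l| <= e * `|h|) ->
  is_derive x 1 f l.
Proof.
move=> H.
have C : (fun h : R => h^-1 *: ((f \o shift x) (h *: (1:R)) - f x)) @ 0^' --> l.
  apply/cvgrPdist_le => /= e /H[d d0 Hd].
  near=> h.
  have h0 : h != 0 by near: h; exact: nbhs_dnbhs_neq.
  have hd : `|h| < d.
    near: h; apply: dnbhs0_lt => //.
  have := Hd _ hd; rewrite -ler_pdivrMr ?normr_gt0 // -normf_div distrC.
  rewrite [X in _ -> `|X| <= _](_ : _ = (f (x + h) - f x - h * l) / h) //.
  rewrite /= [h *: 1]mulr1 [h + x]addrC.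
  by change (h^-1 * (f (x + h) - f x) - l = (f (x + h) - f x - h * l) / h); field.
split; first by apply/cvg_ex; exists l.
exact: cvg_lim.
Unshelve. all: by end_near. Qed.

(** Uniformity over the segment |y| <= M is the tube lemma, by compactness. *)
Lemma segment_tube F (r M e : R) : continuous F -> 0 < e ->
  exists2 d, 0 < d & forall x y, `|x - r| < d -> `|y| <= M ->
    `|F (x, y) - F (r, y)| <= e.
Proof.
move=> cF e0; have := @segment_compact R (- M) M.
move=> /compact_near_coveringP /(_ R (nbhs r)
  (fun x y => `|F (x, y) - F (r, y)| <= e) _) []; last first.
  move=> d /= d0 Hd; exists d => // x y xr yM.
  apply: (Hd x); first by rewrite /= distrC.
  by rewrite /= in_itv /= -ler_norml.
move=> y _.
have := cF (r, y) => /cvgrPdist_le /(_ (e / 2)) /=.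
have e20 : 0 < e / 2 by lra.
move=> /(_ e20) -[[A B] /= [rA yB] AB].
exists (B, A); first by split.
move=> [y' x'] /= [By' Ax'].
have /= := AB (x', y') (conj Ax' By').
have /= := AB (r, y') (conj (nbhs_singleton rA) By').
rewrite (distrC (F (r,y))) => H1; rewrite distrC => H2.
rewrite distrC in H1.
rewrite (_ : _ - _ = (F (x', y') - F (r, y)) + (F (r,y) - F (r, y'))); last by lra.
by rewrite (le_trans (ler_normD _ _)) // [leRHS]splitr lerD // distrC.
Qed.

Lemma pint_near_cst (f : R -> R) (a b k e : R) : continuous f ->
  (forall x, `|x - a| <= `|b - a| -> `|f x - k| <= e) ->
  `|pint f a b - (b - a) * k| <= e * `|b - a|.
Proof.
have H c d : c <= d -> continuous f ->
  (forall x, c <= x <= d -> `|f x - k| <= e) ->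
  `|pint f c d - (d - c) * k| <= e * (d - c).
  move=> cd cf fk.
  have cg : continuous (fun x => f x + - k).
    by move=> x; apply: cvgD; [exact: cf|exact: cvg_cst].
  rewrite [_ * k]mulrC -mulNr -[- k * _]pint_cst // -pintD //; last exact: cst_continuous.
  exact: le_norm_pint.
move=> cf fk; have [ab|/ltW ba] := leP a b.
  rewrite (@ger0_norm _ (b - a)) ?subr_ge0 //; apply: H => // x xab; apply: fk.
  by rewrite !ger0_norm; lra.
rewrite (distrC b) (@ger0_norm _ (a - b)) ?subr_ge0 //.
rewrite [X in `|X|](_ : _ = - (pint f b a - (a - b) * k)); last by rewrite /pint; lra.
rewrite normrN; apply: H => // x xab; apply: fk.
by rewrite !ler0_norm; lra.
Qed.

(** Both the integrand and the domain of integration move. The increment splits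
    into the two short end pieces, on which the integrand is almost constant,
    and the fixed segment, on which the mean value theorem gives an increment
    that is uniformly close to h times the partial derivative. *)
Lemma leibniz_side F DF (r : R) : 0 < r ->
  continuous F -> continuous DF ->
  (forall p, is_derive p ((1, 0) : R * R) F (DF p)) ->
  is_derive r 1 (fun s => pint (fun y => F (s, y)) (- s) s)
    (F (r, r) + F (r, - r) + pint (fun y => DF (r, y)) (- r) r).
Proof.
move=> r0 cF cDF FDF; apply: is_derive_eps => e e0.
have c2 (G : R * R -> R) x : continuous G -> continuous (fun y => G (x, y)).
  move=> cG; apply: continuous_pair => //; first exact: cst_continuous.
  by move=> y; exact: cvg_id.
pose e1 := e / (2 * r + 2).
have e10 : 0 < e1 by rewrite divr_gt0 //; lra.
have [d0 d00 H0] := segment_tube r r cDF e10.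
have e20 : 0 < e1 / 2 by lra.
have [d1 d10 H1] := segment_tube r (r + r) cF e20.
have [d2 d20 H2] : exists2 d, 0 < d &
    forall y, `|y - r| < d -> `|F (r, y) - F (r, r)| <= e1 / 2.
  have /cvgrPdist_le /(_ _ e20) [d /= d0' Hd] := c2 F r cF r.
  by exists d => // y yd; rewrite distrC; apply: Hd; rewrite /= distrC.
have [d3 d30 H3] : exists2 d, 0 < d &
    forall y, `|y - (- r)| < d -> `|F (r, y) - F (r, - r)| <= e1 / 2.
  have /cvgrPdist_le /(_ _ e20) [d /= d0' Hd] := c2 F r cF (- r).
  by exists d => // y yd; rewrite distrC; apply: Hd; rewrite /= distrC.
exists (Num.min r (Num.min (Num.min d0 d1) (Num.min d2 d3))).
  by rewrite !lt_min r0 d00 d10 d20 d30.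
move=> h; rewrite !lt_min => /andP[hr /andP[/andP[h0 h1] /andP[h2 h3]]].
have := hr; rewrite ltr_norml => /andP[hr1 hr2].
set A := fun y => DF (r, y).
have cA : continuous A by exact: c2.
set B := fun y => F (r, y).
have cB : continuous B by exact: c2.
set C := fun y => F (r + h, y).
have cC : continuous C by exact: c2.
have rhr : r + h - r = h by rewrite addrAC subrr add0r.
have T1 : `|pint C (- r) r - pint B (- r) r - h * pint A (- r) r|
    <= e1 * `|h| * (r - - r).
  have rr : - r <= r by lra.
  have cBN : continuous (fun y => -1 * B y).
    by move=> y; apply: cvgM; [exact: cvg_cst|exact: cB].
  have cAN : continuous (fun y => - h * A y).
    by move=> y; apply: cvgM; [exact: cvg_cst|exact: cA].
  have cBA : continuous (fun y => -1 * B y + - h * A y).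
    by move=> y; apply: cvgD; [exact: cBN|exact: cAN].
  rewrite -addrA -mulNr -[- pint B _ _]mulN1r -!pintZ // -!pintD //.
  apply: le_norm_pint => //.
    by move=> y; apply: cvgD; [exact: cC|exact: cBA].
  move=> y yr; rewrite mulN1r mulNr addrA.
  have cDFy : continuous (fun x => DF (x, y)).
    apply: continuous_pair => //; last exact: cst_continuous.
    by move=> x; exact: cvg_id.
  have := @pint_near_cst (fun x => DF (x, y)) r (r + h) (DF (r, y)) e1 cDFy.
  have -> : pint (fun x => DF (x, y)) r (r + h) = F (r + h, y) - F (r, y).
    apply: (@pint_primitive_global _ _ (fun x => F (x, y))) => // x.
    exact: (iffLR (is_derive_horizontal F x y _) (FDF (x, y))).
  rewrite rhr; apply => x xh; apply: H0; first exact: le_lt_trans h0.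
  by rewrite ler_norml.
have small y : `|y| <= r + `|h| -> `|C y - B y| <= e1 / 2.
  move=> yr; apply: H1; last by lra.
  by rewrite rhr.
have T2 : `|pint C r (r + h) - (r + h - r) * F (r, r)| <= e1 * `|r + h - r|.
  apply: pint_near_cst => // y; rewrite rhr => yh.
  have -> : C y - F (r, r) = (C y - B y) + (B y - F (r, r)) by lra.
  rewrite (le_trans (ler_normD _ _)) // [leRHS]splitr lerD //; last first.
    by apply: H2; exact: le_lt_trans h2.
  apply: small; rewrite -[y](subrK r) (le_trans (ler_normD _ _)) //.
  by rewrite (gtr0_norm r0); lra.
have T3 : `|pint C (- r) (- (r + h)) - (- (r + h) - - r) * F (r, - r)|
    <= e1 * `|- (r + h) - - r|.
  have E : - (r + h) - - r = - h by lra.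
  apply: pint_near_cst => // y; rewrite E normrN => yh.
  have -> : C y - F (r, - r) = (C y - B y) + (B y - F (r, - r)) by lra.
  rewrite (le_trans (ler_normD _ _)) // [leRHS]splitr lerD //; last first.
    by apply: H3; exact: le_lt_trans h3.
  apply: small; rewrite -[y](subrK (- r)) (le_trans (ler_normD _ _)) //.
  by rewrite normrN (gtr0_norm r0); lra.
rewrite [X in `|X|](_ : _ =
   (pint C (- r) r - pint B (- r) r - h * pint A (- r) r)
   + (pint C r (r + h) - (r + h - r) * F (r, r))
   - (pint C (- r) (- (r + h)) - (- (r + h) - - r) * F (r, - r))); last first.
  by rewrite /A /B /C /pint; ring.
apply: le_trans (ler_normB _ _) _; apply: le_trans (lerD (ler_normD _ _) (lexx _)) _.
apply: le_trans (lerD (lerD T1 T2) T3) _.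
have -> : - (r + h) - - r = - h by lra.
rewrite rhr normrN.
suff -> : e * `|h| = e1 * (2 * r + 2) * `|h| by lra.
by rewrite /e1 divfK //; lra.
Qed.

End leibniz.

(** * The flux of a field through the boundary of a square *)

Section loops.
Context {R : realType}.
Local Notation plane := (R * R)%type.

(** The quarter turn. The boundary of the square of half-side r is covered by
    the four images of its right side t |-> (r, t), |t| <= r, traversed
    counterclockwise, so statements about the whole boundary reduce to
    statements about the right side. *)
Definition rot (p : plane) : plane := (- p.2, p.1).

(** The pullback of a vector field by the quarter turn; its first component on
    the right side is the outward normal component of the field on the
    corresponding side. *)
Definition rot_field (V : plane -> plane) (p : plane) : plane :=
  ((V (rot p)).2, - (V (rot p)).1).

(** The same operation for pairs of quantities attached to the two coordinate
    directions and insensitive to their orientation, such as the two diagonal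
    partial derivatives of a field. *)
Definition rot_pair (D : plane -> plane) (p : plane) : plane :=
  ((D (rot p)).2, (D (rot p)).1).

Definition loop (Q : plane -> R) (r : R) : R :=
  \sum_(j < 4) pint (fun t => Q (iter j rot (r, t))) (- r) r.

Definition flux (V : plane -> plane) (r : R) : R :=
  \sum_(j < 4) pint (fun t => (iter j rot_field V (r, t)).1) (- r) r.

Lemma rot4 p : rot (rot (rot (rot p))) = p.
Proof. by case: p => x y; rewrite /rot /= !opprK. Qed.

Lemma continuous_fst (T : topologicalType) (V : T -> plane) :
  continuous V -> continuous (fun q => (V q).1).
Proof.
by move=> cV p; apply: (@continuous_comp _ _ _ V fst); [exact: cV|exact: cvg_fst].
Qed.

Lemma continuous_snd (T : topologicalType) (V : T -> plane) :
  continuous V -> continuous (fun q => (V q).2).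
Proof.
by move=> cV p; apply: (@continuous_comp _ _ _ V snd); [exact: cV|exact: cvg_snd].
Qed.

Lemma continuous_mk (T : topologicalType) (f g : T -> R) :
  continuous f -> continuous g -> continuous (fun q => (f q, g q)).
Proof. by move=> cf cg p; exact: (cvg_pair (cf p) (cg p)). Qed.

Lemma continuous_at_cst (T : topologicalType) (k : R) (p : T) :
  {for p, continuous (fun=> k)}.
Proof. exact: cst_continuous. Qed.

Lemma continuous_at_opp (T : topologicalType) (f : T -> R) (p : T) :
  {for p, continuous f} -> {for p, continuous (fun q => - f q)}.
Proof. exact: cvgN. Qed.

Lemma continuous_at_add (T : topologicalType) (f g : T -> R) (p : T) :
  {for p, continuous f} -> {for p, continuous g} ->
  {for p, continuous (fun q => f q + g q)}.
Proof. exact: cvgD. Qed.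

Lemma continuous_at_mul (T : topologicalType) (f g : T -> R) (p : T) :
  {for p, continuous f} -> {for p, continuous g} ->
  {for p, continuous (fun q => f q * g q)}.
Proof. exact: cvgM. Qed.

Lemma continuous_at_inv (T : topologicalType) (f : T -> R) (p : T) :
  f p != 0 -> {for p, continuous f} -> {for p, continuous (fun q => (f q)^-1)}.
Proof. by move=> fp0 cf; exact: cvgV. Qed.

Lemma continuous_at_comp (T : topologicalType) (c : R -> R) (f : T -> R) (p : T) :
  continuous c -> {for p, continuous f} -> {for p, continuous (fun q => c (f q))}.
Proof. by move=> cc cf; apply: (@continuous_comp _ _ _ f c) => //; exact: cc. Qed.

Lemma continuous_opp (T : topologicalType) (f : T -> R) :
  continuous f -> continuous (fun q => - f q).
Proof. by move=> cf p; apply: cvgN; exact: cf. Qed.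

Lemma continuous_add (T : topologicalType) (f g : T -> R) :
  continuous f -> continuous g -> continuous (fun q => f q + g q).
Proof. by move=> cf cg p; apply: cvgD; [exact: cf|exact: cg]. Qed.

Lemma continuous_mul (T : topologicalType) (f g : T -> R) :
  continuous f -> continuous g -> continuous (fun q => f q * g q).
Proof. by move=> cf cg p; apply: cvgM; [exact: cf|exact: cg]. Qed.

Lemma continuous_rot : continuous rot.
Proof.
apply: continuous_mk; last by move=> p; exact: cvg_fst.
by apply: continuous_opp => p; exact: cvg_snd.
Qed.

Lemma continuous_rot_comp (T : topologicalType) (Q : plane -> T) :
  continuous Q -> continuous (Q \o rot).
Proof. by move=> cQ p; apply: continuous_comp; [exact: continuous_rot|exact: cQ]. Qed.

Lemma continuous_iter_rot (T : topologicalType) (Q : plane -> T) j :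
  continuous Q -> continuous (Q \o iter j rot).
Proof.
move=> cQ; elim: j => [//|j IH].
have -> : Q \o iter j.+1 rot = (Q \o iter j rot) \o rot.
  by apply/funext => p; rewrite /= -iterS iterSr.
exact: continuous_rot_comp.
Qed.

Lemma continuous_side (T : topologicalType) (Q : plane -> T) (r : R) :
  continuous Q -> continuous (fun t : R => Q (r, t)).
Proof.
move=> cQ; apply: continuous_pair => //; first exact: cst_continuous.
by move=> y; exact: cvg_id.
Qed.

(** The two components of D are kept apart, rather than only their sum: on each
    side one of them is the normal derivative, which accounts for the motion of
    the side, and the other one is the tangential derivative. *)
Definition is_flow (V D : plane -> plane) : Prop :=
  [/\ continuous V, continuous D,
     forall p, is_derive p ((1, 0) : plane) (fun q => (V q).1) (D p).1 &
     forall p, is_derive p ((0, 1) : plane) (fun q => (V q).2) (D p).2].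

Lemma is_derive_reflect (f : R -> R) (x l : R) :
  is_derive (- x) 1 f l -> is_derive x 1 (fun t => f (- t)) (- l).
Proof.
move=> fl; rewrite -mulrN1.
by apply: (@is_derive1_comp _ f -%R).
Qed.

Lemma is_derive_rot1 (f : plane -> R) p l :
  is_derive (rot p) ((0, 1) : plane) f l ->
  is_derive p ((1, 0) : plane) (f \o rot) l.
Proof. by case: p => x y /is_derive_vertical ?; apply/is_derive_horizontal. Qed.

Lemma is_derive_rot2 (f : plane -> R) p l :
  is_derive (rot p) ((1, 0) : plane) f l ->
  is_derive p ((0, 1) : plane) (f \o rot) (- l).
Proof.
case: p => x y /is_derive_horizontal fl; apply/is_derive_vertical.
exact: (is_derive_reflect fl).
Qed.

Lemma is_flow_rot V D : is_flow V D -> is_flow (rot_field V) (rot_pair D).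
Proof.
case=> cV cD V1 V2.
have cVr := continuous_rot_comp cV; have cDr := continuous_rot_comp cD.
split.
- apply: continuous_mk; first exact: continuous_snd.
  by apply: continuous_opp; exact: continuous_fst.
- by apply: continuous_mk; [exact: continuous_snd|exact: continuous_fst].
- by move=> p; apply: is_derive_rot1; exact: V2.
- move=> p; rewrite -[(rot_pair D p).2]opprK; apply: is_derive_opp.
  by apply: is_derive_rot2; exact: V1.
Qed.

Lemma is_flow_iter V D j :
  is_flow V D -> is_flow (iter j rot_field V) (iter j rot_pair D).
Proof. by move=> VD; elim: j => //= j; exact: is_flow_rot. Qed.

Lemma rot_pair_sum D j p :
  (iter j rot_pair D p).1 + (iter j rot_pair D p).2 =
  (D (iter j rot p)).1 + (D (iter j rot p)).2.
Proof. by elim: j p => //= j IH p; rewrite addrC IH -iterSr. Qed.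

(** The corner values of the second component are traded, by the fundamental
    theorem of calculus along the side, for the integral of its tangential
    derivative, which completes the divergence. *)
Lemma flux_side V D (r : R) : 0 < r -> is_flow V D ->
  is_derive r 1 (fun s => pint (fun t => (V (s, t)).1) (- s) s)
    ((V (r, r)).1 + (V (r, - r)).1 - ((V (r, r)).2 - (V (r, - r)).2)
     + pint (fun t => (D (r, t)).1 + (D (r, t)).2) (- r) r).
Proof.
move=> r0 [cV cD V1 V2]; have rr : - r <= r by lra.
have cD1 := continuous_fst cD; have cD2 := continuous_snd cD.
have E : pint (fun t => (D (r, t)).2) (- r) r = (V (r, r)).2 - (V (r, - r)).2.
  apply: (@pint_primitive _ _ (fun t => (V (r, t)).2)) => //.
    exact: (continuous_side cD2).
  move=> t _.
  exact: (iffLR (is_derive_vertical (fun q => (V q).2) r t _) (V2 (r, t))).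
apply: (is_derive_eq (leibniz_side r0 (continuous_fst cV) cD1 V1)).
rewrite pintD //; first by rewrite E; ring.
  exact: (continuous_side cD1).
exact: (continuous_side cD2).
Qed.

(** The divergence theorem in infinitesimal form: the corner terms of the four
    sides cancel. Differentiating in r avoids integrals over the square. *)
Lemma flux_is_derive V D (r : R) : 0 < r -> is_flow V D ->
  is_derive r 1 (flux V) (loop (fun p => (D p).1 + (D p).2) r).
Proof.
move=> r0 VD.
have H j := flux_side r0 (is_flow_iter j VD).
pose side j s := pint (fun t => (iter j rot_field V (s, t)).1) (- s) s.
have S := @is_derive_sum _ _ _ 4 side r 1 _ (fun j : 'I_4 => H j).
have E : \sum_(j < 4) side j = flux V.
  by apply/funext => s; rewrite /flux fct_sumE.
rewrite E in S; apply: (is_derive_eq S).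
rewrite big_split /= [X in X + _](_ : _ = 0) ?add0r.
  by apply: eq_bigr => j _; apply: eq_pint => t; exact: rot_pair_sum.
by rewrite !big_ord_recl big_ord0 /= /rot_field /rot /= !opprK; ring.
Qed.

End loops.

(** * A weighted Poincare inequality on the boundary of a square *)

Section poincare.
Context {R : realType}.
Local Notation plane := (R * R)%type.

(** With psi(s) = s (T - s) and h = psi'/psi = 1/s - 1/(T-s), one has
    - psi''/psi = 2 / psi >= 8 / T^2, and completing the square in f and df
    bounds the energy e from below by (f^2 h)' plus 8 / T^2 times f^2 m. The
    parabola psi is a comparison function that plays the role of the sine; it
    yields 8 where the sine would yield pi^2. *)
Lemma poincare_pointwise (f df e m s T : R) :
  0 < s -> s < T -> 0 <= e -> 0 <= m -> (f != 0 -> df ^+ 2 <= e * m) ->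
  2 * f * df * (s^-1 - (T - s)^-1)
    + 8 / T ^+ 2 * (f ^+ 2 * m)
  <= e + f ^+ 2 * m * (s ^- 2 + (T - s) ^- 2).
Proof.
move=> s0 sT e0 m0 H; have Ts0 : 0 < T - s by lra.
have [->|/H {}H] := eqVneq f 0.
  by rewrite expr0n /= !(mulr0, mul0r) !addr0.
set h := s^-1 - (T - s)^-1.
have Hh : 8 / T ^+ 2 <= s ^- 2 + (T - s) ^- 2 - h ^+ 2.
  rewrite [leRHS](_ : _ = 2 / (s * (T - s))); last first.
    by rewrite /h; field; apply/andP; split; lra.
  rewrite ler_pdivrMr ?exprn_gt0 //; last lra.
  rewrite mulrAC ler_pdivlMr ?mulr_gt0 //.
  by have := sqr_ge0 (s - (T - s)); nra.
have fm : 0 <= f ^+ 2 * m by rewrite mulr_ge0 ?sqr_ge0.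
have := ler_wpM2l fm Hh.
suff : 2 * f * df * h <= e + f ^+ 2 * m * h ^+ 2 by lra.
have := m0; rewrite le_eqVlt => /predU1P[m00|mpos].
  have : df ^+ 2 <= 0 by move: H; rewrite -m00 mulr0.
  rewrite real_exprn_even_le0 ?num_real //= => /eqP ->.
  by rewrite -m00 !(mulr0, mul0r) addr0.
rewrite -(ler_pM2l mpos).
have := sqr_ge0 (f * m * h - df).
by nra.
Qed.

(** Here s is the parameter with density m. The boundary terms f^2 h are kept,
    so that they telescope when segments are put end to end. *)
Lemma poincare_segment (f df e m s : R -> R) (a b T : R) : a <= b ->
  continuous f -> continuous e -> continuous m ->
  (forall x : R, is_derive x 1 f (df x)) ->
  (forall x : R, is_derive x 1 s (m x)) ->
  (forall x, 0 <= e x) -> (forall x, 0 <= m x) ->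
  (forall x, f x != 0 -> df x ^+ 2 <= e x * m x) ->
  (forall x, a <= x <= b -> 0 < s x < T) ->
  (f b) ^+ 2 * ((s b)^-1 - (T - s b)^-1)
  - (f a) ^+ 2 * ((s a)^-1 - (T - s a)^-1)
  + 8 / T ^+ 2 * pint (fun x => f x ^+ 2 * m x) a b <= pint e a b.
Proof.
move=> ab cf ce cm fdf sm e0 m0 fem sT.
have cf2m : continuous (fun x => f x ^+ 2 * m x).
  by apply: continuous_mul => //; exact: (continuous_mul cf cf).
set h := fun x => (s x)^-1 - (T - s x)^-1.
pose psi x := prim e x - 8 / T ^+ 2 * prim (fun x => f x ^+ 2 * m x) x
   - (f x) ^+ 2 * h x.
suff : psi a <= psi b by rewrite /psi /pint /h; lra.
apply: (@le_of_is_derive _ _ (fun x =>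
   e x - 8 / T ^+ 2 * (f x ^+ 2 * m x) -
   ((f x) ^+ 2 * (- (s x) ^- 2 * m x - - (T - s x) ^- 2 * (- m x))
    + h x * (f x * df x + f x * df x)))) => // x /sT /andP[s0 sTx].
- have ds : is_derive x 1 (fun y => (s y)^-1) (- (s x) ^- 2 * m x).
    by apply: is_deriveV => //; exact: lt0r_neq0.
  have dTs : is_derive x 1 (fun y => T - s y) (- m x).
    by rewrite -[- m x]add0r; apply: is_derive_sub.
  have dTV : is_derive x 1 (fun y => (T - s y)^-1) (- (T - s x) ^- 2 * (- m x)).
    by apply: is_deriveV => //; apply: lt0r_neq0; lra.
  have df2 : is_derive x 1 (fun y => f y ^+ 2) (f x * df x + f x * df x).
    by apply: is_derive_mul.
  apply: is_derive_sub; last by apply: is_derive_mul => //; exact: is_derive_sub.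
  apply: is_derive_sub; first exact: prim_is_derive.
  by apply: is_derive_scale; exact: prim_is_derive.
- have := poincare_pointwise s0 sTx (e0 x) (m0 x) (fem x).
  by rewrite /h; lra.
Qed.

(** The data of a truncated graph that matter for the inequality: the truncated
    height and its partial derivatives, the density of the parameter along the
    curve, and the energy carried by each coordinate direction. *)
Record profile := Profile {
  height : plane -> R; slope : plane -> plane;
  density : plane -> R; energy : plane -> plane }.

(** For a graph the last condition holds with equality; it makes the energy
    along a side dominate the Dirichlet integral of the height with respect to
    the parameter. *)
Definition admissible (P : profile) : Prop :=
  [/\ [/\ continuous (height P), continuous (density P) & continuous (energy P)],
     forall p, is_derive p ((1, 0) : plane) (height P) (slope P p).1 /\
               is_derive p ((0, 1) : plane) (height P) (slope P p).2,
     forall p, [/\ 0 <= density P p, 0 <= (energy P p).1 & 0 <= (energy P p).2] &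
     forall p, height P p != 0 ->
       (slope P p).1 ^+ 2 <= (energy P p).1 * density P p /\
       (slope P p).2 ^+ 2 <= (energy P p).2 * density P p].

Definition rot_profile (P : profile) : profile :=
  Profile (height P \o rot) (rot_field (slope P))
          (density P \o rot) (rot_pair (energy P)).

Definition tangential (e : plane -> plane) (r : R) : R :=
  \sum_(j < 4) pint (fun t => (iter j rot_pair e (r, t)).2) (- r) r.

Lemma rot_admissible P : admissible P -> admissible (rot_profile P).
Proof.
case=> -[cf cm ce] dP P0 Pem; split.
- split; [exact: continuous_rot_comp|exact: continuous_rot_comp|].
  have ce' := continuous_rot_comp ce.
  by apply: continuous_mk; [exact: continuous_snd|exact: continuous_fst].
- move=> p; split; first by apply: is_derive_rot1; exact: (dP _).2.
  by apply: is_derive_rot2; exact: (dP _).1.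
- by move=> p /=; case: (P0 (rot p)).
- by move=> p /= /Pem[]; rewrite sqrrN.
Qed.

Lemma loop_rot (Q : plane -> R) r : loop (Q \o rot) r = loop Q r.
Proof.
rewrite /loop [RHS]big_ord_recl big_ord_recr /= addrC; congr (_ + _).
by apply: eq_pint => t; rewrite rot4.
Qed.

Lemma iter4_rot_pair (e : plane -> plane) : iter 4 rot_pair e = e.
Proof.
by apply/funext => p; rewrite /= /rot_pair /= rot4; case: (e p).
Qed.

Lemma tangential_rot e r : tangential (rot_pair e) r = tangential e r.
Proof.
rewrite /tangential [RHS]big_ord_recl big_ord_recr /= addrC; congr (_ + _).
  by apply: eq_pint => t; rewrite -[in RHS](iter4_rot_pair e).
by apply: eq_bigr => j _; rewrite -iterSr.
Qed.

Lemma height_iter P j : height (iter j rot_profile P) = height P \o iter j rot.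
Proof.
elim: j P => // j IH P; rewrite iterSr IH.
by apply/funext => p; rewrite /= -iterS.
Qed.

Lemma density_iter P j : density (iter j rot_profile P) = density P \o iter j rot.
Proof.
elim: j P => // j IH P; rewrite iterSr IH.
by apply/funext => p; rewrite /= -iterS.
Qed.

Lemma energy_iter P j : energy (iter j rot_profile P) = iter j rot_pair (energy P).
Proof. by elim: j => // j /= ->. Qed.

Lemma admissible_iter P j : admissible P -> admissible (iter j rot_profile P).
Proof. by move=> aP; elim: j => // j; exact: rot_admissible. Qed.

(** The closed curve is cut open at a zero of the height on the right side and
    traversed once: the rest of that side, the three other sides, and the
    beginning of the right side. The parameter starts at eta and ends at
    T - eta, so that h has no singularity; the inner boundary terms telescope
    and the two outer ones vanish. *)
Lemma loop_poincare_start P (r t0 eta : R) : admissible P ->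
  - r <= t0 <= r -> height P (r, t0) = 0 -> 0 < eta ->
  8 * loop (fun p => height P p ^+ 2 * density P p) r <=
  (loop (density P) r + 2 * eta) ^+ 2 * tangential (energy P) r.
Proof.
move=> aP /andP[rt0 t0r] ft0 eta0; have rr : - r <= r by lra.
pose Pj j := iter j rot_profile P.
pose f j t := height (Pj j) (r, t); pose m j t := density (Pj j) (r, t).
pose e j t := (energy (Pj j) (r, t)).2; pose mu j := prim (m j).
have aPj j : admissible (Pj j) by exact: admissible_iter.
have cf j : continuous (f j) by case: (aPj j) => -[c _ _] _ _ _; exact: continuous_side.
have cm j : continuous (m j) by case: (aPj j) => -[_ c _] _ _ _; exact: continuous_side.
have ce j : continuous (e j).
  by case: (aPj j) => -[_ _ c] _ _ _; apply: continuous_snd; exact: continuous_side.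
have dmu j (x : R) : is_derive x 1 (mu j) (m j x) by exact: prim_is_derive.
have m0 j x : 0 <= m j x by case: (aPj j) => _ _ /(_ (r, x))[].
have mule j x y : x <= y -> mu j x <= mu j y.
  by move=> xy; apply: (@le_of_is_derive _ _ (m j)).
pose S := \sum_(j < 4) (mu j r - mu j (- r)).
have ES : S = loop (density P) r.
  by apply: eq_bigr => j _; rewrite /mu /m /Pj density_iter.
pose T := S + 2 * eta.
pose h s := s^-1 - (T - s)^-1.
have seg0 j a b c : - r <= a -> a <= b -> b <= r -> 0 < c + mu j a -> c + mu j b < T ->
    f j b ^+ 2 * ((c + mu j b)^-1 - (T - (c + mu j b))^-1)
    - f j a ^+ 2 * ((c + mu j a)^-1 - (T - (c + mu j a))^-1)
    + 8 / T ^+ 2 * pint (fun x => f j x ^+ 2 * m j x) a b <= pint (e j) a b.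
  move=> ra ab br ca cb; case: (aPj j) => _ dP eP fP.
  apply: (@poincare_segment (f j) (fun t => (slope (Pj j) (r, t)).2) (e j) (m j)
    (fun x => c + mu j x)) => //.
  - by move=> x; exact: (iffLR (is_derive_vertical (height (Pj j)) r x _) (dP (r, x)).2).
  - by move=> x; rewrite -[m j x]add0r; apply: is_derive_add; exact: is_derive_const.
  - by move=> x; case: (eP (r, x)).
  - by move=> x /(fP (r, x))[].
  - move=> x /andP[/(mule j) ax /(mule j) xb]; apply/andP; split; lra.
have glue j : f j r = f j.+1 (- r).
  by rewrite /f /Pj !height_iter /= -iterS iterSr /rot /= opprK.
have glue4 : f 4 (- r) = f 0 (- r).
  by rewrite /f /Pj height_iter /= rot4.
have S4 : S = (mu 0 r - mu 0 (- r)) + (mu 1 r - mu 1 (- r)) + (mu 2 r - mu 2 (- r))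
    + (mu 3 r - mu 3 (- r)).
  by rewrite /S !big_ord_recl big_ord0 /=; lra.
have T0 : 0 < T.
  by rewrite /T S4; have := mule 0 _ _ rr; have := mule 1 _ _ rr;
    have := mule 2 _ _ rr; have := mule 3 _ _ rr; lra.
have seg j a b c : - r <= a -> a <= b -> b <= r -> 0 < c -> c + (mu j b - mu j a) < T ->
    f j b ^+ 2 * h (c + (mu j b - mu j a)) - f j a ^+ 2 * h c
    + 8 / T ^+ 2 * pint (fun x => f j x ^+ 2 * m j x) a b <= pint (e j) a b.
  have E1 : c - mu j a + mu j b = c + (mu j b - mu j a) by lra.
  have := seg0 j a b (c - mu j a); rewrite E1 subrK; exact.
have M0 := mule 0 _ _ rt0; have M0' := mule 0 _ _ t0r.
have M1 := mule 1 _ _ rr; have M2 := mule 2 _ _ rr; have M3 := mule 3 _ _ rr.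
(* The values of the parameter at the four corners. *)
pose c1 := eta + (mu 0 r - mu 0 t0); pose c2 := c1 + (mu 1 r - mu 1 (- r)).
pose c3 := c2 + (mu 2 r - mu 2 (- r)); pose c4 := c3 + (mu 3 r - mu 3 (- r)).
have f00 : f 0 t0 = 0 by exact: ft0.
have I0 := @seg 0 t0 r eta rt0 t0r (lexx r) eta0 ltac:(rewrite /T S4; lra).
have I1 := @seg 1 (- r) r c1 (lexx _) rr (lexx r)
  ltac:(rewrite /c1; lra) ltac:(rewrite /c1 /T S4; lra).
have I2 := @seg 2 (- r) r c2 (lexx _) rr (lexx r)
  ltac:(rewrite /c2 /c1; lra) ltac:(rewrite /c2 /c1 /T S4; lra).
have I3 := @seg 3 (- r) r c3 (lexx _) rr (lexx r)
  ltac:(rewrite /c3 /c2 /c1; lra) ltac:(rewrite /c3 /c2 /c1 /T S4; lra).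
have I4 := @seg 0 (- r) t0 c4 (lexx _) rt0 t0r
  ltac:(rewrite /c4 /c3 /c2 /c1; lra) ltac:(rewrite /c4 /c3 /c2 /c1 /T S4; lra).
rewrite -/c1 f00 in I0; rewrite -/c2 -glue in I1; rewrite -/c3 -glue in I2.
rewrite -/c4 -glue in I3; rewrite f00 -glue4 -glue in I4.
have key : 8 / T ^+ 2 * loop (fun p => height P p ^+ 2 * density P p) r <=
    tangential (energy P) r.
  rewrite [tangential _ _](_ : _ = \sum_(j < 4) pint (e j) (- r) r); last first.
    by apply: eq_bigr => j _; apply: eq_pint => t; rewrite /e /Pj energy_iter.
  rewrite [loop _ _](_ : _ =
    \sum_(j < 4) pint (fun x => f j x ^+ 2 * m j x) (- r) r); last first.
    apply: eq_bigr => j _; apply: eq_pint => t.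
    by rewrite /f /m /Pj height_iter density_iter.
  rewrite !big_ord_recl !big_ord0 /= /bump /=.
  have split0 g : pint g (- r) r = pint g (- r) t0 + pint g t0 r by rewrite /pint; lra.
  rewrite !(split0 (e 0)) !(split0 (fun x => f 0 x ^+ 2 * m 0 x)).
  have := I0; have := I1; have := I2; have := I3; have := I4.
  move: (8 / T ^+ 2) => K; lra.
rewrite -ES -/T.
rewrite [leLHS](_ : _ = T ^+ 2 *
  (8 / T ^+ 2 * loop (fun p => height P p ^+ 2 * density P p) r)).
  by rewrite ler_wpM2l // sqr_ge0.
by field; exact: lt0r_neq0.
Qed.

End poincare.

(** * The growth of the flux *)

Section growth.
Context {R : realType}.
Local Notation plane := (R * R)%type.

Definition on_loop (r : R) (p : plane) : Prop :=
  exists j t, - r <= t <= r /\ p = iter j rot (r, t).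

(** By rotation, the zero may lie on any of the four sides. *)
Lemma loop_poincare P (r eta : R) : admissible P ->
  (exists2 p, on_loop r p & height P p = 0) -> 0 < eta ->
  8 * loop (fun p => height P p ^+ 2 * density P p) r <=
  (loop (density P) r + 2 * eta) ^+ 2 * tangential (energy P) r.
Proof.
move=> aP [_ [j [t [tr ->]]] Pt0] eta0; elim: j P aP Pt0 => [|j IH] P aP Pt0.
  exact: (loop_poincare_start aP tr).
have := IH _ (rot_admissible aP) Pt0; rewrite /= tangential_rot loop_rot.
by rewrite (loop_rot (fun p => height P p ^+ 2 * density P p)).
Qed.

(** The pointwise form of the Cauchy-Schwarz inequality, to be integrated along
    the sides; for graphs it comes from [cut2] <= [ramp] * [cut]. *)
Definition controlled (V : plane -> plane) (P : profile) : Prop :=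
  forall p,
    (V p).1 ^+ 2 <= height P p ^+ 2 * density P p * (energy P p).1 /\
    (V p).2 ^+ 2 <= height P p ^+ 2 * density P p * (energy P p).2.

Lemma controlled_rot V P : controlled V P -> controlled (rot_field V) (rot_profile P).
Proof. by move=> VP p /=; have [] := VP (rot p); rewrite sqrrN. Qed.

Lemma controlled_iter V P j : controlled V P ->
  controlled (iter j rot_field V) (iter j rot_profile P).
Proof. by move=> VP; elim: j => // j; exact: controlled_rot. Qed.

Lemma le_half_of_sqr_le (v A B l : R) : 0 <= A -> 0 <= B -> 0 < l ->
  v ^+ 2 <= A * B -> v <= (l * A + l^-1 * B) / 2.
Proof.
move=> A0 B0 l0 vAB; have [v0|v0] := leP v 0.
  by rewrite (le_trans v0) // divr_ge0 // addr_ge0 // mulr_ge0 // ?invr_ge0 ltW.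
rewrite -ler_sqr ?nnegrE; [|exact: ltW|]; last first.
  by rewrite divr_ge0 // addr_ge0 // mulr_ge0 // ?invr_ge0 ltW.
apply: (le_trans vAB); have := sqr_ge0 (l * A - l^-1 * B).
have : l * l^-1 = 1 by rewrite divff // lt0r_neq0.
move: (l^-1) => k lk.
have -> : A * B = l * A * (k * B) by rewrite mulrACA lk mul1r.
by nra.
Qed.

(** On each side, weighted Cauchy-Schwarz with weight c / T bounds the normal
    component of V by height^2 * density and the normal energy; the loop
    inequality trades the former for the tangential energy. With c = 14/5 one
    has c^2 <= 8, and both energies acquire the factor T / (2 c). *)
Lemma flux_growth_eta V D P (r eta : R) : 0 < r -> admissible P -> is_flow V D ->
  controlled V P ->
  (forall p, (D p).1 + (D p).2 = (energy P p).1 + (energy P p).2) ->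
  (exists2 p, on_loop r p & height P p = 0) -> 0 < eta ->
  28 / 5 * flux V r <=
    (loop (density P) r + 2 * eta) * loop (fun p => (D p).1 + (D p).2) r.
Proof.
move=> r0 aP VD VP DE zP eta0; have rr : - r <= r by lra.
have LP := loop_poincare aP zP eta0.
set T := _ + 2 * eta in LP *.
have S0 : 0 <= loop (density P) r.
  apply: sumr_ge0 => j _; apply: pint_ge0 => //.
    by case: aP => -[_ cm _] _ _ _; apply: (continuous_side (continuous_iter_rot cm)).
  by move=> t _; case: aP => _ _ /(_ (iter j rot (r, t)))[].
have T0 : 0 < T by rewrite /T; lra.
pose normal := \sum_(j < 4) pint (fun t => (iter j rot_pair (energy P) (r, t)).1) (- r) r.
have ce j : continuous (iter j rot_pair (energy P)).
  by case: (admissible_iter j aP) => -[_ _]; rewrite energy_iter.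
have EN : loop (fun p => (D p).1 + (D p).2) r = normal + tangential (energy P) r.
  rewrite -big_split /=; apply: eq_bigr => j _; rewrite -pintD //.
  - by apply: eq_pint => t; rewrite rot_pair_sum DE.
  - exact: (continuous_side (continuous_fst (ce j))).
  - exact: (continuous_side (continuous_snd (ce j))).
have l0 : 0 < 14 / 5 / T by rewrite divr_gt0 //; lra.
have H : flux V r <= (14 / 5 / T / 2) * loop (fun p => height P p ^+ 2 * density P p) r
     + (14 / 5 / T)^-1 / 2 * normal.
  rewrite !mulr_sumr -big_split /=; apply: ler_sum => j _.
  case: (admissible_iter j aP) => -[cf cm _] _ P0 _.
  have cfm : continuous (fun t =>
      height P (iter j rot (r, t)) ^+ 2 * density P (iter j rot (r, t))).
    rewrite height_iter density_iter in cf cm.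
    have cf' := continuous_side cf (r := r); have cm' := continuous_side cm (r := r).
    by apply: continuous_mul => //; exact: (continuous_mul cf' cf').
  have cn := continuous_side (continuous_fst (ce j)) (r := r).
  have ck (k : R) (g : R -> R) : continuous g -> continuous (fun t => k * g t).
    by apply: continuous_mul; exact: cst_continuous.
  rewrite -!pintZ // -pintD //; try exact: ck.
  apply: le_pint => //.
  - have [cVj _ _ _] := is_flow_iter j VD.
    exact: (continuous_side (continuous_fst cVj)).
  - by apply: continuous_add; exact: ck.
  move=> t _; have [+ _] := controlled_iter j VP (r, t).
  rewrite height_iter density_iter energy_iter => /le_half_of_sqr_le -/(_ _ _ _ l0) H.
  have := P0 (r, t); rewrite density_iter energy_iter => -[m0 e10 _].
  rewrite [leRHS](_ : _ = (14 / 5 / T *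
      (height P (iter j rot (r, t)) ^+ 2 * density P (iter j rot (r, t)))
    + (14 / 5 / T)^-1 * (iter j rot_pair (energy P) (r, t)).1) / 2); last by ring.
  by apply: H => //=; rewrite mulr_ge0 // sqr_ge0.
have E0 : 0 <= tangential (energy P) r.
  apply: sumr_ge0 => j _; apply: pint_ge0 => //.
    exact: (continuous_side (continuous_snd (ce j))).
  move=> t _; have [_ _ P0 _] := admissible_iter j aP.
  by have := P0 (r, t); rewrite energy_iter => -[].
rewrite EN mulrDr.
have H2 : 28 / 5 * (14 / 5 / T / 2 * loop (fun p => height P p ^+ 2 * density P p) r)
   <= T * tangential (energy P) r.
  rewrite [leLHS](_ : _ = (14 / 5) ^+ 2 / 8 / T *
    (8 * loop (fun p => height P p ^+ 2 * density P p) r)); last first.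
    by field; exact: lt0r_neq0.
  have k0 : 0 <= (14 / 5 : R) ^+ 2 / 8 / T by rewrite divr_ge0 ?ltW.
  apply: (le_trans (ler_wpM2l k0 LP)).
  rewrite [leLHS](_ : _ = (14 / 5) ^+ 2 / 8 *
    (T * tangential (energy P) r)); last first.
    by field; exact: lt0r_neq0.
  have := mulr_ge0 (ltW T0) E0; lra.
have H3 : 28 / 5 * ((14 / 5 / T)^-1 / 2 * normal) = T * normal.
  by field; exact: lt0r_neq0.
by lra.
Qed.

Lemma flux_growth V D P (r : R) : 0 < r -> admissible P -> is_flow V D ->
  controlled V P ->
  (forall p, (D p).1 + (D p).2 = (energy P p).1 + (energy P p).2) ->
  (exists2 p, on_loop r p & height P p = 0) ->
  28 / 5 * flux V r <= loop (density P) r * loop (fun p => (D p).1 + (D p).2) r.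
Proof.
move=> r0 aP VD VP DE zP; apply/ler_addgt0Pr => e e0.
set B := loop (fun p => (D p).1 + (D p).2) r.
have B1 : 0 < `|B| + 1 by rewrite ltr_pwDr.
have eta0 : 0 < e / (`|B| + 1) / 2 by rewrite !divr_gt0.
apply: (le_trans (flux_growth_eta r0 aP VD VP DE zP eta0)).
rewrite mulrDl lerD2l -/B [leLHS](_ : _ = e * (B / (`|B| + 1))); last first.
  by field; exact: lt0r_neq0.
rewrite ler_piMr ?(ltW e0) // ler_pdivrMr // mul1r.
by rewrite (le_trans (ler_norm _)) // lerDl.
Qed.

Lemma le_loop (Q Q' : plane -> R) (r : R) : 0 <= r -> continuous Q -> continuous Q' ->
  (forall p, Q p <= Q' p) -> loop Q r <= loop Q' r.
Proof.
move=> r0 cQ cQ' QQ'; apply: ler_sum => j _; apply: le_pint => //; first lra.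
  exact: (continuous_side (continuous_iter_rot cQ)).
exact: (continuous_side (continuous_iter_rot cQ')).
Qed.

Lemma loop_cst (k r : R) : 0 <= r -> loop (fun=> k) r = 8 * r * k.
Proof.
move=> r0; rewrite /loop !big_ord_recl big_ord0 /= !pint_cst; lra.
Qed.

Lemma loopD (Q Q' : plane -> R) (r : R) : 0 <= r -> continuous Q -> continuous Q' ->
  loop (fun p => Q p + Q' p) r = loop Q r + loop Q' r.
Proof.
move=> r0 cQ cQ'; rewrite -big_split /=; apply: eq_bigr => j _.
rewrite pintD //; first lra.
  exact: (continuous_side (continuous_iter_rot cQ)).
exact: (continuous_side (continuous_iter_rot cQ')).
Qed.

Lemma rot_field_bound V (j : nat) (r k : R) :
  (forall p, on_loop r p -> `|(V p).1| <= k /\ `|(V p).2| <= k) ->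
  forall p, on_loop r p ->
    `|(iter j rot_field V p).1| <= k /\ `|(iter j rot_field V p).2| <= k.
Proof.
move=> Vk; elim: j => // j IH _ [i [t [tr ->]]] /=; rewrite normrN.
have [|] // := IH (rot (iter i rot (r, t))).
by exists i.+1, t.
Qed.

Lemma flux_bound V D (r k : R) : 0 <= r -> is_flow V D ->
  (forall p, on_loop r p -> `|(V p).1| <= k /\ `|(V p).2| <= k) ->
  `|flux V r| <= 8 * r * k.
Proof.
move=> r0 VD Vk; rewrite -(loop_cst _ r0) (le_trans (ler_norm_sum _ _ _)) //.
apply: ler_sum => j _; rewrite pint_cst; last lra.
apply: le_norm_pint; first lra.
  have [cVj _ _ _] := is_flow_iter j VD.
  exact: (continuous_side (continuous_fst cVj)).
move=> t tr; have [|+ _] := rot_field_bound j Vk (p := (r, t)) => //.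
by exists 0, t.
Qed.

End growth.

(** * Three fluxes cannot grow together *)

Section competition.
Context {R : realType}.

(** The tangent line to 1/S at S = 8 r / 3, an equal share of the perimeter,
    makes the lower bound linear in S, hence summable over the graphs. *)
Lemma log_growth (F dF S r : R) : 0 < r -> 0 < F -> 0 <= S ->
  28 / 5 * F <= S * dF ->
  28 / 5 * (3 / (4 * r) - 9 * S / (64 * r ^+ 2)) <= F^-1 * dF.
Proof.
move=> r0 F0 S0 H.
have Spos : 0 < S.
  rewrite lt_neqAle S0 andbT; apply: contraTneq H => <-.
  by rewrite mul0r -ltNge mulr_gt0.
apply: (@le_trans _ _ (28 / 5 * S^-1)).
  rewrite ler_wpM2l //.
  rewrite -subr_ge0 [leRHS](_ : _ = (8 * r - 3 * S) ^+ 2 / (64 * r ^+ 2 * S)); last first.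
    by field; rewrite !lt0r_neq0.
  by rewrite divr_ge0 ?sqr_ge0 ?mulr_ge0 ?sqr_ge0 ?ltW.
rewrite -(ler_pM2l Spos) -(ler_pM2l F0); move: H.
rewrite [X in _ -> X <= _](_ : _ = 28 / 5 * F); last by field; rewrite !lt0r_neq0.
rewrite [X in _ -> _ <= X](_ : _ = S * dF) //; by field; rewrite !lt0r_neq0.
Qed.

(** The function L is the logarithm of the product of the fluxes, corrected so
    as to be nondecreasing. The term Psi / (64 r^2) absorbs Psi'/(64 r^2); what
    it leaves, Psi / (32 r^3), is at most 1 / (320 r), whence
    39/320 = 1/8 - 1/320. The resulting exponent 252/5 * 39/320 = 6.1425
    exceeds 6, while the product of the fluxes is at most r^6. *)
Lemma no_three_growing (Phi dPhi S : 'I_3 -> R -> R) (Psi dPsi : R -> R) (r0 : R) :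
  0 < r0 ->
  (forall (i : 'I_3) (r : R), r0 <= r -> is_derive r 1 (Phi i) (dPhi i r)) ->
  (forall i r, r0 <= r -> 0 < Phi i r <= r ^+ 2) ->
  (forall i r, r0 <= r -> 0 <= S i r) ->
  (forall i r, r0 <= r -> 28 / 5 * Phi i r <= S i r * dPhi i r) ->
  (forall r : R, r0 <= r -> is_derive r 1 Psi (dPsi r)) ->
  (forall r, r0 <= r -> Psi r <= r ^+ 2 / 10) ->
  (forall r, r0 <= r -> \sum_i S i r <= 8 * r + dPsi r) ->
  False.
Proof.
move=> r00 dPhiE Phi_b S_ge0 grow dPsiE Psi_b S_b.
pose L r := \sum_i ln (Phi i r)
   - 252 / 5 * (39 / 320 * ln r - Psi r * ((64 * (r * r))^-1)).
pose dL r := \sum_i ((Phi i r)^-1 * dPhi i r)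
   - 252 / 5 * (39 / 320 * r^-1
     - (Psi r * (- (64 * (r * r)) ^- 2 * (64 * (r * 1 + r * 1)))
        + (64 * (r * r))^-1 * dPsi r)).
have dLE (r : R) : r0 <= r -> is_derive r 1 L (dL r).
  move=> rr0; have rpos : 0 < r by lra.
  apply: is_derive_sub.
    have := @is_derive_sum _ _ _ 3 (fun i s => ln (Phi i s)) r 1
      (fun i => (Phi i r)^-1 * dPhi i r).
    have -> : \sum_(i < 3) (fun s => ln (Phi i s)) = (fun s => \sum_i ln (Phi i s)).
      by apply/funext => s; rewrite fct_sumE.
    apply=> i; have /andP[P0 _] := Phi_b i r rr0.
    by apply: (@is_derive1_comp _ (@ln R)); [exact: is_derive1_ln|exact: dPhiE].
  have dln : is_derive r 1 (fun s : R => 39 / 320 * ln s) (39 / 320 * r^-1).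
    by apply: is_derive_scale; exact: is_derive1_ln.
  have did : is_derive r 1 (fun s : R => s) 1 by exact: is_derive_id.
  have d64 : is_derive r 1 (fun s : R => 64 * (s * s)) (64 * (r * 1 + r * 1)).
    by apply: is_derive_scale; exact: is_derive_mul.
  have dV : is_derive r 1 (fun s : R => (64 * (s * s))^-1)
      (- (64 * (r * r)) ^- 2 * (64 * (r * 1 + r * 1))).
    by apply: is_deriveV => //; rewrite lt0r_neq0 // !mulr_gt0.
  apply: is_derive_scale; apply: is_derive_sub => //.
  by apply: is_derive_mul => //; exact: dPsiE.
have dL0 r : r0 <= r -> 0 <= dL r.
  move=> rr0; have rpos : 0 < r by lra.
  have r2 : 0 < r ^+ 2 by rewrite exprn_gt0.
  have k0 : 0 <= 252 / 5 / (64 * r ^+ 2).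
    by apply: divr_ge0; lra.
  have Hsum : 252 / 5 * (1 / (8 * r) - dPsi r / (64 * r ^+ 2)) <=
      \sum_i ((Phi i r)^-1 * dPhi i r).
    apply: (@le_trans _ _ (\sum_i (28 / 5 * (3 / (4 * r) - 9 * S i r / (64 * r ^+ 2))))).
      have := S_b _ rr0; rewrite !big_ord_recl !big_ord0.
      move: (S _ r) => s0; move: (S _ r) => s1; move: (S _ r) => s2 H.
      rewrite -subr_ge0 [leRHS](_ : _ =
        252 / 5 / (64 * r ^+ 2) * (8 * r + dPsi r - (s0 + (s1 + (s2 + 0))))); last first.
        by field; rewrite lt0r_neq0.
      by rewrite mulr_ge0 // subr_ge0.
    apply: ler_sum => i _; apply: log_growth => //; last exact: grow.
      by case/andP: (Phi_b i r rr0).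
    exact: S_ge0.
  rewrite -subr_ge0 in Hsum; rewrite /dL.
  rewrite [leRHS](_ : _ = \sum_i ((Phi i r)^-1 * dPhi i r)
      - 252 / 5 * (1 / (8 * r) - dPsi r / (64 * r ^+ 2))
      + 252 / 160 / r ^+ 3 * (r ^+ 2 / 10 - Psi r)); last first.
    by field; rewrite lt0r_neq0.
  have r3 : 0 <= 252 / 160 / r ^+ 3.
    by apply: divr_ge0; [lra|rewrite exprn_ge0 // ltW].
  apply: addr_ge0; first exact: Hsum.
  by apply: mulr_ge0; [exact: r3|rewrite subr_ge0; exact: Psi_b].
have Lmono r : r0 <= r -> L r0 <= L r.
  move=> rr0; apply: (@le_of_is_derive _ L dL) => // x /andP[x0 _].
    exact: dLE.
  exact: dL0.
have Lle r : r0 <= r -> L r <= 252 / 3200 - 57 / 400 * ln r.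
  move=> rr0; have rpos : 0 < r by lra.
  have H1 : \sum_i ln (Phi i r) <= \sum_(i < 3) (2 * ln r).
    apply: ler_sum => i _; have /andP[P0 Pr] := Phi_b i r rr0.
    have -> : 2 * ln r = ln (r ^+ 2) by rewrite lnXn // mulr_natl.
    by rewrite ler_ln ?posrE // exprn_gt0.
  have H2 : Psi r * (64 * (r * r))^-1 <= 1 / 640.
    rewrite ler_pdivrMr ?mulr_gt0 //; have := Psi_b _ rr0; lra.
  move: H1; rewrite !big_ord_recl !big_ord0 /L !big_ord_recl !big_ord0 /=; lra.
pose X := (252 / 3200 - L r0 + 1) * (400 / 57).
pose r := Num.max r0 (expR X).
have rr0 : r0 <= r by rewrite le_max lexx.
have lnr : X <= ln r.
  rewrite -[X]expRK ler_ln ?posrE ?expR_gt0 //; last by lra.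
  by rewrite le_max lexx orbT.
have := Lmono _ rr0; have := Lle _ rr0.
have k0 : 0 <= 57 / 400 :> R by lra.
have := ler_wpM2l k0 lnr.
by rewrite /X; lra.
Qed.

End competition.

(** * The flux is eventually positive *)

Section positivity.
Context {R : realType}.
Local Notation plane := (R * R)%type.

Lemma pint_gt0 (f : R -> R) (a b x0 : R) : a < b -> continuous f ->
  (forall x, 0 <= f x) -> a <= x0 <= b -> 0 < f x0 -> 0 < pint f a b.
Proof.
move=> ab cf f0 /andP[ax0 x0b] fx0.
have fx02 : 0 < f x0 / 2 by rewrite divr_gt0.
have /cvgrPdist_le /(_ _ fx02) /nbhs_ballP [d /= d0 Hd] := cf x0.
pose c := Num.max a (x0 - d / 2); pose e := Num.min b (x0 + d / 2).
have ac : a <= c by rewrite le_max lexx.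
have eb : e <= b by rewrite ge_min lexx.
have d20 : 0 < d / 2 by rewrite divr_gt0.
have ce : c < e by rewrite /c /e lt_min !gt_max ab /=; apply/and3P; split; lra.
have -> : pint f a b = pint f a c + pint f c e + pint f e b by rewrite /pint; lra.
have i1 : 0 <= pint f a c by apply: pint_ge0.
have i3 : 0 <= pint f e b by apply: pint_ge0.
suff : f x0 / 2 * (e - c) <= pint f c e.
  have : 0 < f x0 / 2 * (e - c) by rewrite mulr_gt0 // subr_gt0.
  lra.
rewrite -pint_cst; last exact: ltW.
apply: le_pint => //; [exact: ltW|exact: cst_continuous|move=> x /andP[cx xe]].
have xd : `|x0 - x| < d.
  move: cx xe; rewrite /c /e ge_max le_min => /andP[_ h1] /andP[_ h2].
  by rewrite ltr_norml; apply/andP; split; lra.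
by have := Hd _ xd; rewrite ler_norml => /andP[_]; lra.
Qed.

Lemma on_loop_max (p : plane) : on_loop (Num.max `|p.1| `|p.2|) p.
Proof.
case: p => x y /=; case: (lerP `|y| `|x|) => [yx|/ltW xy].
  have := yx; rewrite ler_norml => yr.
  have [x0|x0] := leP 0 x.
    by exists 0, y; rewrite ger0_norm //= ger0_norm // in yr *.
  exists 2, (- y); rewrite ltr0_norm // in yr *; split; last by rewrite /rot /= !opprK.
  by move/andP: yr => [? ?]; apply/andP; split; lra.
have := xy; rewrite ler_norml => xr.
have [y0|y0] := leP 0 y.
  exists 1, (- x); rewrite ger0_norm // in xr *; split; last by rewrite /rot /= opprK.
  by move/andP: xr => [? ?]; apply/andP; split; lra.
exists 3, x; rewrite ltr0_norm // in xr *; split => //.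
by rewrite /rot /= !opprK.
Qed.

Lemma on_loop_norm (r : R) (p : plane) : on_loop r p -> `|p.1| <= r /\ `|p.2| <= r.
Proof.
move=> [j [t [tr ->]]]; have r0 : 0 <= r by lra.
elim: j => [|j [h1 h2]] /=; last by rewrite normrN.
by rewrite ger0_norm // ler_norml.
Qed.

Lemma on_loop_enorm (r : R) (p : plane) : 0 <= r -> on_loop r p -> r <= enorm p <= 2 * r.
Proof.
move=> r0 lp; have [h1 h2] := on_loop_norm lp.
have q1 : p.1 ^+ 2 <= r ^+ 2.
  by rewrite -[p.1 ^+ 2]real_normK ?num_real // lerXn2r ?nnegrE.
have q2 : p.2 ^+ 2 <= r ^+ 2.
  by rewrite -[p.2 ^+ 2]real_normK ?num_real // lerXn2r ?nnegrE.
have s0 : 0 <= p.1 ^+ 2 + p.2 ^+ 2 by rewrite addr_ge0 ?sqr_ge0.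
have q3 : r ^+ 2 <= p.1 ^+ 2 + p.2 ^+ 2.
  case: lp => j [t [_ ->]] {h1 h2 q1 q2 s0}; elim: j => [|j IH] /=.
    by rewrite lerDl sqr_ge0.
  by rewrite sqrrN addrC.
rewrite -[X in X <= _]ger0_norm // -sqrtr_sqr ler_wsqrtr //=.
by rewrite -[leRHS]ger0_norm ?mulr_ge0 // -sqrtr_sqr ler_wsqrtr //; nra.
Qed.

Lemma loop_gt0 (Q : plane -> R) (r : R) (p : plane) : 0 < r -> continuous Q ->
  (forall q, 0 <= Q q) -> on_loop r p -> 0 < Q p -> 0 < loop Q r.
Proof.
move=> r0 cQ Q0 [j [t [tr ->]]]; elim: j Q cQ Q0 => [|j IH] Q cQ Q0 Qp.
  rewrite /loop big_ord_recl /= ltr_pwDl //.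
    apply: (@pint_gt0 _ _ _ t) => //; first lra.
    exact: continuous_side.
  apply: sumr_ge0 => i _; apply: pint_ge0 => //; first lra.
  exact: (continuous_side (continuous_iter_rot (j := i.+1) cQ)).
rewrite -loop_rot; apply: IH => //; first exact: continuous_rot_comp.
by move=> q /=.
Qed.

Lemma flux_le V D (r s : R) : 0 < r -> r <= s -> is_flow V D ->
  (forall p, 0 <= (D p).1 + (D p).2) -> flux V r <= flux V s.
Proof.
move=> r0 rs VD D0; have [_ cD _ _] := VD.
apply: (@le_of_is_derive _ _ (loop (fun p => (D p).1 + (D p).2))) => // x /andP[rx _].
  by apply: flux_is_derive => //; lra.
have <- : @loop R (fun=> 0) x = 0 by rewrite loop_cst ?mulr0; lra.
apply: le_loop => //; [lra|exact: cst_continuous|].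
by apply: continuous_add; [exact: continuous_fst|exact: continuous_snd].
Qed.

(** The flux is nondecreasing, and it tends to 0 with the side of the square. *)
Lemma flux_ge0 V D (r : R) : 0 < r -> is_flow V D ->
  (forall p, 0 <= (D p).1 + (D p).2) -> 0 <= flux V r.
Proof.
move=> r0 VD D0; have [cV _ _ _] := VD.
have c1 : continuous (fun p => (V p).1) by exact: continuous_fst.
have c2 : continuous (fun p => (V p).2) by exact: continuous_snd.
have /cvgrPdist_le /(_ 1 ltr01) /nbhs_ballP [d /= d0 Hd1] := c1 (0, 0).
have /cvgrPdist_le /(_ 1 ltr01) /nbhs_ballP [d' /= d'0 Hd2] := c2 (0, 0).
pose K := `|(V (0, 0)).1| + `|(V (0, 0)).2| + 1.
have K0 : 0 < K by rewrite ltr_wpDl // addr_ge0.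
apply/ler_addgt0Pr => e e0.
pose s := Num.min (Num.min r (e / (8 * K))) (Num.min (d / 2) (d' / 2)).
have s0 : 0 < s by rewrite !lt_min r0 !divr_gt0 // mulr_gt0.
have := lexx s; rewrite {2}/s !le_min => /andP[/andP[sr se] /andP[sd sd']].
have Vle := flux_le s0 sr VD D0.
have : `|flux V s| <= 8 * s * K.
  apply: (flux_bound (ltW s0) VD) => -[x y] /on_loop_norm /= [xs ys].
  have B (h : R) : 0 < h -> s <= h / 2 -> ball (0 : R, 0 : R) h (x, y).
    by move=> h0 sh; split; rewrite /ball /= sub0r normrN; lra.
  have := Hd1 (x, y) (B _ d0 sd); have := Hd2 (x, y) (B _ d'0 sd').
  rewrite /= => H2 H1; split.
    have := ler_normB (V (0, 0)).1 ((V (0, 0)).1 - (V (x, y)).1).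
    by rewrite opprB addrCA subrr addr0 /K; have := normr_ge0 (V (0, 0)).2; lra.
  have := ler_normB (V (0, 0)).2 ((V (0, 0)).2 - (V (x, y)).2).
  by rewrite opprB addrCA subrr addr0 /K; have := normr_ge0 (V (0, 0)).1; lra.
rewrite ler_norml => /andP[h _].
have : 8 * s * K <= e by move: se; rewrite ler_pdivlMr ?mulr_gt0 //; lra.
lra.
Qed.

(** If the flux vanished for some larger square, then, being nonnegative and
    nondecreasing, it would vanish for all smaller ones; but its derivative is
    positive at the square whose boundary contains p0. *)
Lemma flux_gt0 V D (p0 : plane) : is_flow V D ->
  (forall p, 0 <= (D p).1 + (D p).2) -> 0 < (D p0).1 + (D p0).2 ->
  exists2 r0, 0 < r0 & forall r, r0 <= r -> 0 < flux V r.
Proof.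
move=> VD D0; have [_ cD _ _] := VD.
have cS : continuous (fun p => (D p).1 + (D p).2).
  by apply: continuous_add; [exact: continuous_fst|exact: continuous_snd].
(* The origin lies on no side of positive length; by continuity p0 can be moved. *)
wlog p00 : p0 / 0 < Num.max `|p0.1| `|p0.2|.
  move=> H Dp0; have [|] := ltP 0 (Num.max `|p0.1| `|p0.2|) => [p0p|].
    exact: (H p0).
  rewrite ge_max !normr_le0 => /andP[/eqP x0 /eqP y0].
  have /cvgrPdist_lt /(_ _ Dp0) /nbhs_ballP [e /= e0 He] := cS p0.
  apply: (H (e / 2, e / 2)) => /=.
    by rewrite lt_max normr_gt0 lt0r_neq0 // divr_gt0.
  have e2 : 0 < e / 2 by rewrite divr_gt0.
  have : ball p0 e (e / 2, e / 2).
    by split; rewrite /ball /= ?x0 ?y0 sub0r normrN ger0_norm; lra.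
  by move=> /He /=; rewrite ltr_norml => /andP[_]; lra.
move=> Dp0; set r1 := Num.max _ _ in p00.
exists (r1 + 1); first lra.
move=> r r1r; rewrite lt_neqAle (@flux_ge0 _ D) ?andbT; [|lra|by []|by []].
apply/eqP => F0.
have Fz s : 0 < s -> s <= r -> flux V s = 0.
  move=> s0 sr; apply/eqP; rewrite eq_le (@flux_ge0 _ D) // andbT F0.
  exact: (@flux_le _ D).
have dF := flux_is_derive p00 VD.
have near0 : \forall s \near r1, flux V s = (fun=> 0 : R) s.
  near=> s; apply: Fz.
    by near: s; exact: lt_nbhsr.
  apply: ltW; apply: (lt_le_trans _ r1r).
  by near: s; apply: lt_nbhsl; rewrite ltrDl.
have := near_eq_is_derive near0 dF => -[_ ]; rewrite derive_cst => E.
suff : 0 < loop (fun p => (D p).1 + (D p).2) r1 by rewrite -E ltxx.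
have [j [t [tr p0E]]] := on_loop_max p0; rewrite -/r1 in tr p0E.
apply: (@loop_gt0 _ _ (iter j rot (r1, t))) => //; last by rewrite -p0E.
by exists j, t.
Unshelve. all: by end_near.
Qed.
End positivity.

(** * Truncations *)

Section truncation.
Context {R : realType}.
Local Notation plane := (R * R)%type.

Definition ramp (d a t : R) : R := Num.min 1 (Num.max 0 ((t - a) / d)).

(** The truncation [cut] is applied to u to define the height, and [cut2] to
    define the field. Since the derivative of [cut2] is the square of that of
    [cut], the divergence of the field is the energy of the height; and
    [cut2] <= [ramp] * [cut] since [ramp] is nondecreasing. *)
Definition cut (d a t : R) : R := pint (ramp d a) a t.

Definition cut2 (d a t : R) : R := pint (fun s => ramp d a s ^+ 2) a t.

Lemma ramp01 d a t : 0 <= ramp d a t <= 1.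
Proof. by rewrite /ramp le_min ge_min lexx le_max lexx ler01. Qed.

Lemma ramp_eq0 d a t : 0 < d -> t <= a -> ramp d a t = 0.
Proof.
move=> d0 ta; rewrite /ramp max_l ?min_r //.
by rewrite ler_pdivrMr // mul0r subr_le0.
Qed.

Lemma ramp_eq1 d a t : 0 < d -> a + d <= t -> ramp d a t = 1.
Proof.
move=> d0 ta; have : 1 <= (t - a) / d by rewrite ler_pdivlMr // mul1r; lra.
by move=> h; rewrite /ramp min_l // le_max h orbT.
Qed.

Lemma ramp_le d a s t : 0 < d -> s <= t -> ramp d a s <= ramp d a t.
Proof.
move=> d0 st; have : (s - a) / d <= (t - a) / d.
  by rewrite ler_wpM2r ?invr_ge0 ?(ltW d0) // lerD2r.
by move=> h; rewrite /ramp le_min2 // le_max2.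
Qed.

Lemma continuous_ramp d a : continuous (ramp d a).
Proof.
move=> t; apply: (@continuous_min R R (fun=> 1)
  (fun s => Num.max 0 ((s - a) / d))); first exact: cst_continuous.
apply: (@continuous_max R R (fun=> 0) (fun s => (s - a) / d)).
  exact: cst_continuous.
by apply: cvgM; [apply: cvgB; [exact: cvg_id|exact: cvg_cst]|exact: cvg_cst].
Qed.

Lemma continuous_ramp2 d a : continuous (fun s => ramp d a s ^+ 2).
Proof. exact: (continuous_mul (@continuous_ramp d a) (@continuous_ramp d a)). Qed.

Lemma is_derive_cut d a (t : R) : is_derive t 1 (cut d a) (ramp d a t).
Proof.
rewrite -[ramp d a t]subr0; apply: is_derive_sub.
by apply: prim_is_derive; exact: continuous_ramp.
Qed.

Lemma is_derive_cut2 d a (t : R) : is_derive t 1 (cut2 d a) (ramp d a t ^+ 2).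
Proof.
rewrite -[ramp d a t ^+ 2]subr0; apply: is_derive_sub.
exact: (prim_is_derive (@continuous_ramp2 d a)).
Qed.

Lemma pint_eq0 (f : R -> R) (a b : R) : a <= b -> continuous f ->
  (forall x, a <= x <= b -> f x = 0) -> pint f a b = 0.
Proof.
move=> ab cf f0; have : `|pint f a b| <= 0 * (b - a).
  by apply: le_norm_pint => // x /f0 ->; rewrite normr0.
by rewrite mul0r normr_le0 => /eqP.
Qed.

Lemma pint_swap (f : R -> R) (a b : R) : pint f a b = - pint f b a.
Proof. by rewrite /pint opprB. Qed.

Lemma cut_eq0 d a t : 0 < d -> t <= a -> cut d a t = 0.
Proof.
move=> d0 ta; rewrite /cut pint_swap pint_eq0 ?oppr0 //; first exact: continuous_ramp.
by move=> x /andP[_ xa]; rewrite ramp_eq0.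
Qed.

Lemma cut2_eq0 d a t : 0 < d -> t <= a -> cut2 d a t = 0.
Proof.
move=> d0 ta; rewrite /cut2 pint_swap pint_eq0 ?oppr0 //; first exact: continuous_ramp2.
by move=> x /andP[_ xa]; rewrite ramp_eq0 // expr0n.
Qed.

Lemma cut_gt0 d a t : 0 < d -> a + d <= t -> 0 < cut d a t.
Proof.
move=> d0 adt; apply: (@pint_gt0 _ _ _ _ t); first lra.
- exact: continuous_ramp.
- by move=> x; have /andP[] := ramp01 d a x.
- by apply/andP; split; lra.
- by rewrite ramp_eq1.
Qed.

Lemma cut2_ge0 d a t : 0 < d -> 0 <= cut2 d a t.
Proof.
move=> d0; have [ta|/ltW ta] := leP t a; first by rewrite cut2_eq0.
apply: pint_ge0 => //; first exact: continuous_ramp2.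
by move=> x _; rewrite sqr_ge0.
Qed.

Lemma cut2_le_ramp_cut d a t : 0 < d -> cut2 d a t <= ramp d a t * cut d a t.
Proof.
move=> d0; have [ta|/ltW ta] := leP t a.
  by rewrite cut2_eq0 // cut_eq0 // mulr0.
rewrite -pintZ //; last exact: continuous_ramp.
apply: le_pint => //; first exact: continuous_ramp2.
  by apply: continuous_mul; [exact: cst_continuous|exact: continuous_ramp].
move=> x /andP[_ xt]; rewrite expr2 ler_wpM2r //; last exact: ramp_le.
by have /andP[] := ramp01 d a x.
Qed.

Lemma cut2_le d a t : 0 < d -> 0 <= a -> 0 <= t -> cut2 d a t <= t.
Proof.
move=> d0 a0 t0; have [ta|/ltW ta] := leP t a; first by rewrite cut2_eq0.
apply: (@le_trans _ _ (t - a)); last by lra.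
rewrite -[t - a]mul1r -pint_cst //; apply: le_pint => //.
- exact: continuous_ramp2.
- exact: cst_continuous.
- by move=> x _; have /andP[r0 r1] := ramp01 d a x; rewrite expr_le1.
Qed.

End truncation.

(** * Extension by zero *)

Section extension.
Context {R : realType}.
Local Notation plane := (R * R)%type.

(** Along the line h |-> p + h v the chain rule becomes one-dimensional. *)
Lemma is_derive_comp_dir (V : normedModType R) (c : R -> R) (F : V -> R)
    (p v : V) (l d : R) :
  is_derive (F p) 1 c l -> is_derive p v F d -> is_derive p v (c \o F) (l * d).
Proof.
move=> cl Fd.
have H : is_derive (0 : R) 1 (fun h : R => F (h *: v + p)) d.
  by apply: is_derive_line Fd => h; rewrite [h *: (1 : R)]mulr1 addr0.
apply: (@is_derive_line _ R V (fun h : R => c (F (h *: v + p))) (c \o F) 0 1).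
  by move=> h; rewrite [h *: (1 : R)]mulr1 addr0.
apply: (@is_derive1_comp _ c (fun h : R => F (h *: v + p))) => //.
by rewrite scale0r add0r.
Qed.

(** At a boundary point this is continuity up to the boundary together with the
    vanishing boundary values. It is what makes extension by zero harmless. *)
Lemma small_near_outside (Omega : set plane) (u : plane -> R) (a : R) (p : plane) :
  {within closure Omega, continuous u} -> open Omega ->
  (forall q, boundary Omega q -> u q = 0) -> 0 < a ->
  ~ Omega p -> \forall q \near p, Omega q -> u q < a.
Proof.
move=> cu oO u0 a0 nOp; have [cOp|ncOp] := pselect (closure Omega p); last first.
  have : \forall q \near p, (~` closure Omega) q.
    by apply: open_nbhs_nbhs; split => //; apply: closed_openC; exact: closed_closure.
  by apply: filterS => q nq Oq; exfalso; apply: nq; exact: subset_closure.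
have up : u p = 0 by apply: u0; split => // ip; apply: nOp; exact: interior_subset.
have : u q @[q --> within (closure Omega) (nbhs p)] --> (0 : R).
  by rewrite -up; move/subspace_continuousP: cu; apply.
move=> /cvgrPdist_lt /(_ a a0); rewrite near_withinE => H.
apply: filterS H => q Hq Oq; have := Hq (subset_closure Oq).
by rewrite sub0r normrN ltr_norml => /andP[].
Qed.

Lemma continuous_at_domain (Omega : set plane) (u : plane -> R) (p : plane) :
  {within closure Omega, continuous u} -> open Omega -> Omega p ->
  {for p, continuous u}.
Proof.
move=> cu oO Op.
have H : u q @[q --> within (closure Omega) (nbhs p)] --> u p.
  by move/subspace_continuousP: cu; apply; exact: subset_closure.
rewrite within_interior // in H.
apply: (filterS (@subset_closure _ Omega)); exact: open_nbhs_nbhs.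
Qed.

Definition zext (Omega : set plane) (h : plane -> R) : plane -> R :=
  patch (fun=> 0) Omega h.

Lemma zextT (Omega : set plane) h p : Omega p -> zext Omega h p = h p.
Proof. by move=> Op; rewrite /zext patchT // inE. Qed.

Lemma zextN (Omega : set plane) h p : ~ Omega p -> zext Omega h p = 0.
Proof. by move=> Op; rewrite /zext patchN // notin_setE. Qed.

Section extend_by_zero.
Context (Omega : set plane) (u : plane -> R) (a : R).
Context (oO : open Omega)
  (small : forall p, ~ Omega p -> \forall q \near p, Omega q -> u q < a).

Lemma zext_near h p : (forall q, Omega q -> u q < a -> h q = 0) ->
  if `[< Omega p >] then \forall q \near p, h q = zext Omega h q
  else \forall q \near p, 0 = zext Omega h q.
Proof.
move=> h0; case: asboolP => Op.
  have : \forall q \near p, Omega q by exact: open_nbhs_nbhs.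
  by apply: filterS => q Oq; rewrite zextT.
apply: filterS (small Op) => q uq; have [Oq|Oq] := pselect (Omega q).
  by rewrite zextT // h0 //; exact: uq.
by rewrite zextN.
Qed.

Lemma continuous_zext h : (forall q, Omega q -> u q < a -> h q = 0) ->
  (forall p, Omega p -> {for p, continuous h}) -> continuous (zext Omega h).
Proof.
move=> h0 ch p; have := @zext_near h p h0; case: asboolP => Op hz.
  rewrite /continuous_at zextT //.
  by apply: cvg_trans (ch p Op); apply: near_eq_cvg; apply: filterS hz => q ->.
rewrite /continuous_at zextN //.
apply: cvg_trans (@cvg_cst _ (0 : R) _ (nbhs p) _); apply: near_eq_cvg.
by apply: filterS hz => q ->.
Qed.

Lemma is_derive_zext h (l : plane -> R) (v p : plane) :
  (forall q, Omega q -> u q < a -> h q = 0) ->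
  (forall q, Omega q -> is_derive q v h (l q)) ->
  is_derive p v (zext Omega h) (zext Omega l p).
Proof.
move=> h0 hl; have := @zext_near h p h0; case: asboolP => Op hz.
  by rewrite zextT //; apply: (near_eq_is_derive hz); exact: hl.
by rewrite zextN //; apply: (@near_eq_is_derive _ _ _ (fun=> 0) _ _ _ _ hz).
Qed.

End extend_by_zero.
End extension.

(** * The conormal field of a graph *)

Section graph.
Context {R : realType}.
Local Notation plane := (R * R)%type.

(** The area element W of the graph. *)
Definition area (u : plane -> R) (q : plane) : R :=
  Num.sqrt (1 + enorm (grad u q) ^+ 2).

Definition normal1 u q := (area u q)^-1 * partial1 u q.
Definition normal2 u q := (area u q)^-1 * partial2 u q.

Lemma area_sqr u q : area u q ^+ 2 = 1 + (partial1 u q ^+ 2 + partial2 u q ^+ 2).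
Proof.
rewrite /area sqr_sqrtr; last by rewrite addr_ge0 ?sqr_ge0.
by rewrite /enorm sqr_sqrtr // addr_ge0 ?sqr_ge0.
Qed.

Lemma area_ge1 u q : 1 <= area u q.
Proof.
rewrite -[X in X <= _]sqrtr1 ler_wsqrtr // lerDl sqr_ge0 //.
Qed.

Lemma area_gt0 u q : 0 < area u q.
Proof. exact: lt_le_trans ltr01 (area_ge1 u q). Qed.

Lemma areaE u : area u =
  (fun q => Num.sqrt (1 + (partial1 u q * partial1 u q + partial2 u q * partial2 u q))).
Proof.
by apply/funext => q; rewrite -!expr2 -area_sqr sqrtr_sqr ger0_norm // ltW ?area_gt0.
Qed.

(** The derivative of w / W in a direction in which the derivatives of w and of
    the two partial derivatives of u are dw, d1 and d2; the explicit formula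
    shows that it is continuous. *)
Definition dnormal (u w : plane -> R) (dw d1 d2 : R) (p : plane) : R :=
  (area u p)^-1 * dw + w p * (- (area u p) ^- 2 * ((2 * area u p)^-1 *
    (0 + (partial1 u p * d1 + partial1 u p * d1
          + (partial2 u p * d2 + partial2 u p * d2))))).

Lemma is_derive_normal (u w : plane -> R) (p v : plane) (dw d1 d2 : R) :
  is_derive p v (partial1 u) d1 -> is_derive p v (partial2 u) d2 ->
  is_derive p v w dw ->
  is_derive p v (fun q => (area u q)^-1 * w q) (dnormal u w dw d1 d2 p).
Proof.
move=> u1 u2 dwE; apply: is_derive_mul => //.
apply: (@is_derive_comp_dir _ _ (fun t => t^-1) (area u)).
  rewrite -[- _ ^- 2]mulr1; apply: is_deriveV => //.
  by rewrite lt0r_neq0 // area_gt0.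
have E : (2 * area u p)^-1 = (2 * Num.sqrt (1 +
    (partial1 u p * partial1 u p + partial2 u p * partial2 u p)))^-1.
  by rewrite areaE.
rewrite E areaE; apply: (@is_derive_comp_dir _ _ Num.sqrt).
  apply: is_derive1_sqrt; rewrite -!expr2 ltr_pwDl // addr_ge0 ?sqr_ge0 //.
Qed.

End graph.

(** * Truncated graphs *)

Section truncated_graph.
Context {R : realType}.
Local Notation plane := (R * R)%type.
Context (Omega : set plane) (u : plane -> R).
Implicit Types (d a : R) (p q : plane).

Definition dnormal1 p : R :=
  dnormal u (partial1 u) (partial1 (partial1 u) p)
    (partial1 (partial1 u) p) (partial1 (partial2 u) p) p.

Definition dnormal2 p : R :=
  dnormal u (partial2 u) (partial2 (partial2 u) p)
    (partial2 (partial1 u) p) (partial2 (partial2 u) p) p.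

Definition graph_flow d a p : plane :=
  (zext Omega (fun q => cut2 d a (u q) * normal1 u q) p,
   zext Omega (fun q => cut2 d a (u q) * normal2 u q) p).

Definition graph_div d a p : plane :=
  (zext Omega (fun q => cut2 d a (u q) * dnormal1 q +
     normal1 u q * (ramp d a (u q) ^+ 2 * partial1 u q)) p,
   zext Omega (fun q => cut2 d a (u q) * dnormal2 q +
     normal2 u q * (ramp d a (u q) ^+ 2 * partial2 u q)) p).

(** The density is cut off at a lower level b than the height: when
    b + d <= a it equals W wherever the height is positive, and yet it vanishes
    near the boundary of Omega, hence is continuous on the plane. *)
Definition graph_profile d a b : profile := Profile
  (zext Omega (fun q => cut d a (u q)))
  (fun p => (zext Omega (fun q => ramp d a (u q) * partial1 u q) p,
             zext Omega (fun q => ramp d a (u q) * partial2 u q) p))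
  (zext Omega (fun q => ramp d b (u q) ^+ 2 * area u q))
  (fun p => (zext Omega (fun q => ramp d a (u q) ^+ 2 * partial1 u q ^+ 2 / area u q) p,
             zext Omega (fun q => ramp d a (u q) ^+ 2 * partial2 u q ^+ 2 / area u q) p)).

Lemma graph_flowT d a p : Omega p -> graph_flow d a p =
  (cut2 d a (u p) * normal1 u p, cut2 d a (u p) * normal2 u p).
Proof. by move=> Op; congr pair; exact: zextT. Qed.

Lemma graph_flowN d a p : ~ Omega p -> graph_flow d a p = (0, 0).
Proof. by move=> Op; congr pair; exact: zextN. Qed.

Lemma graph_divT d a p : Omega p -> graph_div d a p =
  (cut2 d a (u p) * dnormal1 p + normal1 u p * (ramp d a (u p) ^+ 2 * partial1 u p),
   cut2 d a (u p) * dnormal2 p + normal2 u p * (ramp d a (u p) ^+ 2 * partial2 u p)).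
Proof. by move=> Op; congr pair; exact: zextT. Qed.

Lemma graph_divN d a p : ~ Omega p -> graph_div d a p = (0, 0).
Proof. by move=> Op; congr pair; exact: zextN. Qed.

Lemma graph_slopeT d a b p : Omega p -> slope (graph_profile d a b) p =
  (ramp d a (u p) * partial1 u p, ramp d a (u p) * partial2 u p).
Proof. by move=> Op; congr pair; exact: zextT. Qed.

Lemma graph_slopeN d a b p : ~ Omega p -> slope (graph_profile d a b) p = (0, 0).
Proof. by move=> Op; congr pair; exact: zextN. Qed.

Lemma graph_energyT d a b p : Omega p -> energy (graph_profile d a b) p =
  (ramp d a (u p) ^+ 2 * partial1 u p ^+ 2 / area u p,
   ramp d a (u p) ^+ 2 * partial2 u p ^+ 2 / area u p).
Proof. by move=> Op; congr pair; exact: zextT. Qed.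

Lemma graph_energyN d a b p : ~ Omega p -> energy (graph_profile d a b) p = (0, 0).
Proof. by move=> Op; congr pair; exact: zextN. Qed.

Lemma graph_heightT d a b p : Omega p ->
  height (graph_profile d a b) p = cut d a (u p).
Proof. exact: zextT. Qed.

Lemma graph_heightN d a b p : ~ Omega p -> height (graph_profile d a b) p = 0.
Proof. exact: zextN. Qed.

Lemma graph_densityT d a b p : Omega p ->
  density (graph_profile d a b) p = ramp d b (u p) ^+ 2 * area u p.
Proof. exact: zextT. Qed.

Lemma graph_densityN d a b p : ~ Omega p -> density (graph_profile d a b) p = 0.
Proof. exact: zextN. Qed.

Context (G : minimal_graph Omega u) (S : supported Omega u).

Let oO : open Omega. Proof. by case: G. Qed.

Let small a p : 0 < a -> ~ Omega p -> \forall q \near p, Omega q -> u q < a.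
Proof. by case: G => _ _ _ cu _; case: S => u0 _ _ a0; exact: small_near_outside. Qed.

Lemma graph_is_derive p : Omega p ->
  [/\ is_derive p ((1, 0) : plane) u (partial1 u p),
     is_derive p ((0, 1) : plane) u (partial2 u p) &
     [/\ is_derive p ((1, 0) : plane) (partial1 u) (partial1 (partial1 u) p),
     is_derive p ((0, 1) : plane) (partial1 u) (partial2 (partial1 u) p),
     is_derive p ((1, 0) : plane) (partial2 u) (partial1 (partial2 u) p) &
     is_derive p ((0, 1) : plane) (partial2 u) (partial2 (partial2 u) p)]].
Proof.
move=> Op; case: G => _ _ [C0 C1 C2] _ _.
case: (C0 p Op) => ? ? _ _; case: (C1 p Op) => ? ? _ _; case: (C2 p Op) => ? ? _ _.
by split; [exact: derivableP|exact: derivableP|split; exact: derivableP].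
Qed.

(** This is the minimal surface equation. *)
Lemma minimal_surface_dnormal p : Omega p -> dnormal1 p + dnormal2 p = 0.
Proof.
move=> Op; have [d1 d2 [d11 d12 d21 d22]] := graph_is_derive Op.
case: G => _ _ _ _ /(_ p Op) <-.
have N1 := is_derive_normal d11 d21 d11; have N2 := is_derive_normal d12 d22 d22.
rewrite /divergence /partial1 /partial2; congr (_ + _); apply/esym.
  exact: (@derive_val _ _ _ _ _ _ _ N1).
exact: (@derive_val _ _ _ _ _ _ _ N2).
Qed.

Lemma graph_continuous p : Omega p ->
  [/\ {for p, continuous u}, {for p, continuous (partial1 u)},
    {for p, continuous (partial2 u)}, {for p, continuous (area u)} &
    {for p, continuous (fun q => (area u q)^-1)}].
Proof.
move=> Op; case: G => _ _ [C0 _ _] cu _; case: (C0 p Op) => _ _ c1 c2.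
have ca : {for p, continuous (area u)}.
  rewrite areaE; exact: (continuous_at_comp (@sqrt_continuous R)
    (continuous_at_add (@continuous_at_cst R _ 1 p)
      (continuous_at_add (continuous_at_mul c1 c1) (continuous_at_mul c2 c2)))).
split => //; first exact: (continuous_at_domain cu oO).
exact: (continuous_at_inv (lt0r_neq0 (area_gt0 u p)) ca).
Qed.

Lemma dnormal_continuous p (w dw d1 d2 : plane -> R) : Omega p ->
  {for p, continuous w} -> {for p, continuous dw} ->
  {for p, continuous d1} -> {for p, continuous d2} ->
  {for p, continuous (fun q => dnormal u w (dw q) (d1 q) (d2 q) q)}.
Proof.
move=> Op cw cdw cd1 cd2; have [_ c1 c2 ca ci] := graph_continuous Op.
have A0 := lt0r_neq0 (area_gt0 u p).
have A2 : 2 * area u p != 0 by rewrite mulf_neq0.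
have ca2 := continuous_at_mul (@continuous_at_cst R _ 2 p) ca.
have cs1 := continuous_at_mul c1 cd1; have cs2 := continuous_at_mul c2 cd2.
have cs := continuous_at_add (@continuous_at_cst R _ 0 p)
  (continuous_at_add (continuous_at_add cs1 cs1) (continuous_at_add cs2 cs2)).
have cN := continuous_at_opp
  (@continuous_at_inv R _ (fun q => area u q ^+ 2) p (expf_neq0 2 A0)
    (continuous_at_mul ca ca)).
have cI := @continuous_at_inv R _ (fun q => 2 * area u q) p A2 ca2.
exact: (continuous_at_add (continuous_at_mul ci cdw)
  (continuous_at_mul cw (continuous_at_mul cN (continuous_at_mul cI cs)))).
Qed.

Lemma continuous_cutoff_at (c : R -> R) p : continuous c -> Omega p ->
  {for p, continuous (fun q => c (u q))}.
Proof.
move=> cc Op; have [cu _ _ _ _] := graph_continuous Op.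
exact: continuous_at_comp.
Qed.

Lemma graph_is_flow d a : 0 < d -> 0 < a -> is_flow (graph_flow d a) (graph_div d a).
Proof.
move=> d0 a0.
have lo p : ~ Omega p -> \forall q \near p, Omega q -> u q < a by exact: small.
have ccut2 : continuous (cut2 d a).
  by move=> t; exact: is_derive_continuous (is_derive_cut2 d a t).
have cN p : Omega p -> {for p, continuous (normal1 u)} /\ {for p, continuous (normal2 u)}.
  move=> Op; have [_ c1 c2 _ ci] := graph_continuous Op.
  by split; [exact: (continuous_at_mul ci c1)|exact: (continuous_at_mul ci c2)].
have cR p : Omega p -> {for p, continuous (fun q => ramp d a (u q) ^+ 2)}.
  move=> Op; apply: (continuous_cutoff_at (c := fun t => ramp d a t ^+ 2)) => //.
  exact: continuous_ramp2.
have cd1 p : Omega p -> {for p, continuous dnormal1}.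
  move=> Op; have [_ c1 c2 _ _] := graph_continuous Op; case: G => _ _ [_ C1 C2] _ _.
  case: (C1 p Op) => _ _ ? ?; case: (C2 p Op) => _ _ ? ?.
  exact: dnormal_continuous.
have cd2 p : Omega p -> {for p, continuous dnormal2}.
  move=> Op; have [_ c1 c2 _ _] := graph_continuous Op; case: G => _ _ [_ C1 C2] _ _.
  case: (C1 p Op) => _ _ ? ?; case: (C2 p Op) => _ _ ? ?.
  exact: dnormal_continuous.
have z2 q : u q < a -> cut2 d a (u q) = 0 by move=> /ltW; exact: cut2_eq0.
have zr q : u q < a -> ramp d a (u q) = 0 by move=> /ltW; exact: ramp_eq0.
split.
- apply: continuous_mk; apply: (continuous_zext (u := u) (a := a)) => //.
  + by move=> q _ /z2 ->; rewrite mul0r.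
  + move=> p Op.
    exact: (continuous_at_mul (continuous_cutoff_at ccut2 Op) (cN p Op).1).
  + by move=> q _ /z2 ->; rewrite mul0r.
  + move=> p Op.
    exact: (continuous_at_mul (continuous_cutoff_at ccut2 Op) (cN p Op).2).
- apply: continuous_mk; apply: (continuous_zext (u := u) (a := a)) => //.
  + by move=> q _ ua; rewrite z2 // zr // expr0n /= !mul0r mulr0 addr0.
  + move=> p Op; have [_ c1 c2 _ _] := graph_continuous Op.
    exact: (continuous_at_add
      (continuous_at_mul (continuous_cutoff_at ccut2 Op) (cd1 p Op))
      (continuous_at_mul (cN p Op).1 (continuous_at_mul (cR p Op) c1))).
  + by move=> q _ ua; rewrite z2 // zr // expr0n /= !mul0r mulr0 addr0.
  + move=> p Op; have [_ c1 c2 _ _] := graph_continuous Op.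
    exact: (continuous_at_add
      (continuous_at_mul (continuous_cutoff_at ccut2 Op) (cd2 p Op))
      (continuous_at_mul (cN p Op).2 (continuous_at_mul (cR p Op) c2))).
- move=> p; apply: (is_derive_zext oO lo) => q; first by move=> _ /z2 ->; rewrite mul0r.
  move=> Oq; have [d1 d2 [d11 d12 d21 d22]] := graph_is_derive Oq.
  apply: is_derive_mul.
    by apply: (@is_derive_comp_dir _ _ (cut2 d a) u) => //; exact: is_derive_cut2.
  exact: (is_derive_normal d11 d21 d11).
- move=> p; apply: (is_derive_zext oO lo) => q; first by move=> _ /z2 ->; rewrite mul0r.
  move=> Oq; have [d1 d2 [d11 d12 d21 d22]] := graph_is_derive Oq.
  apply: is_derive_mul.
    by apply: (@is_derive_comp_dir _ _ (cut2 d a) u) => //; exact: is_derive_cut2.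
  exact: (is_derive_normal d12 d22 d22).
Qed.

Lemma graph_admissible d a b : 0 < d -> 0 < b -> b + d <= a ->
  admissible (graph_profile d a b).
Proof.
move=> d0 b0 ba; have a0 : 0 < a by lra.
have lo p : ~ Omega p -> \forall q \near p, Omega q -> u q < a by exact: small.
have lob p : ~ Omega p -> \forall q \near p, Omega q -> u q < b by exact: small.
have zr q : u q < a -> ramp d a (u q) = 0 by move=> /ltW; exact: ramp_eq0.
have cR c p : Omega p -> {for p, continuous (fun q => ramp d c (u q) ^+ 2)}.
  move=> Op; apply: (continuous_cutoff_at (c := fun t => ramp d c t ^+ 2)) => //.
  exact: continuous_ramp2.
split.
- split.
  + apply: (continuous_zext oO lo); first by move=> q _ /ltW /cut_eq0; apply.
    move=> p; apply: continuous_cutoff_at => t.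
    exact: is_derive_continuous (is_derive_cut d a t).
  + apply: (continuous_zext oO lob).
      by move=> q _ /ltW h; rewrite ramp_eq0 // expr0n /= mul0r.
    move=> p Op; have [_ _ _ ca _] := graph_continuous Op.
    exact: (continuous_at_mul (cR b p Op) ca).
  + apply: continuous_mk; apply: (continuous_zext oO lo).
    * by move=> q _ /zr ->; rewrite expr0n /= !mul0r.
    * move=> p Op; have [_ c1 c2 _ ci] := graph_continuous Op.
      exact: (continuous_at_mul (continuous_at_mul (cR a p Op)
        (continuous_at_mul c1 c1)) ci).
    * by move=> q _ /zr ->; rewrite expr0n /= !mul0r.
    * move=> p Op; have [_ c1 c2 _ ci] := graph_continuous Op.
      exact: (continuous_at_mul (continuous_at_mul (cR a p Op)
        (continuous_at_mul c2 c2)) ci).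
- move=> p; split; apply: (is_derive_zext oO lo) => q;
    try (by move=> _ /ltW /cut_eq0; apply).
    move=> Oq; have [d1 _ _] := graph_is_derive Oq.
    by apply: (@is_derive_comp_dir _ _ (cut d a) u) => //; exact: is_derive_cut.
  move=> Oq; have [_ d2 _] := graph_is_derive Oq.
  by apply: (@is_derive_comp_dir _ _ (cut d a) u) => //; exact: is_derive_cut.
- move=> p; have [Op|Op] := pselect (Omega p); last first.
    by rewrite graph_densityN // graph_energyN.
  rewrite graph_densityT // graph_energyT //; have A0 := ltW (area_gt0 u p).
  have E w : 0 <= ramp d a (u p) ^+ 2 * w ^+ 2 / area u p.
    by rewrite divr_ge0 // mulr_ge0 // sqr_ge0.
  by split; [rewrite mulr_ge0 // sqr_ge0|exact: E|exact: E].
- move=> p; have [Op|Op] := pselect (Omega p); last by rewrite graph_heightN // eqxx.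
  rewrite graph_heightT // graph_slopeT // graph_energyT // graph_densityT // => c0.
  have ua : a <= u p.
    by rewrite leNgt; apply: contra_neqN c0 => /ltW; exact: cut_eq0.
  have A0 := lt0r_neq0 (area_gt0 u p).
  have E w : (ramp d a (u p) * w) ^+ 2 <=
      ramp d a (u p) ^+ 2 * w ^+ 2 / area u p * (ramp d b (u p) ^+ 2 * area u p).
    by rewrite (@ramp_eq1 _ d b) ?expr1n ?mul1r ?divfK ?exprMn //; lra.
  by split; exact: E.
Qed.

Lemma continuous_graph_cutoff d b : 0 < d -> 0 < b ->
  continuous (zext Omega (fun q => ramp d b (u q) ^+ 2)).
Proof.
move=> d0 b0; apply: (continuous_zext (u := u) (a := b)) => //.
- by move=> p; exact: small.
- by move=> q _ /ltW h; rewrite ramp_eq0 // expr0n.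
- move=> p Op; apply: (continuous_cutoff_at (c := fun t => ramp d b t ^+ 2)) => //.
  exact: continuous_ramp2.
Qed.

Lemma graph_controlled d a b : 0 < d -> b + d <= a ->
  controlled (graph_flow d a) (graph_profile d a b).
Proof.
move=> d0 ba p; have [Op|Op] := pselect (Omega p); last first.
  rewrite graph_flowN // graph_heightN // graph_energyN //=.
  by rewrite expr0n /= !mul0r.
rewrite graph_flowT // graph_heightT // graph_densityT // graph_energyT //.
have A0 := area_gt0 u p; have A1 := area_ge1 u p.
have Ai : (area u p)^-1 <= 1 by rewrite invf_le1.
have key w : (cut2 d a (u p) * ((area u p)^-1 * w)) ^+ 2 <=
    cut d a (u p) ^+ 2 * (ramp d b (u p) ^+ 2 * area u p) *
    (ramp d a (u p) ^+ 2 * w ^+ 2 / area u p).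
  have [ua|/ltW ua] := leP a (u p); last first.
    rewrite cut2_eq0 // mul0r expr0n /=; apply: mulr_ge0.
      by rewrite mulr_ge0 ?sqr_ge0 // mulr_ge0 ?sqr_ge0 // ltW.
    by rewrite divr_ge0 ?(ltW A0) // mulr_ge0 // sqr_ge0.
  rewrite (@ramp_eq1 _ d b) //; last by lra.
  rewrite [leRHS](_ : _ = (ramp d a (u p) * cut d a (u p)) ^+ 2 * w ^+ 2); last first.
    by field; exact: lt0r_neq0.
  rewrite mulrA exprMn ler_wpM2r ?sqr_ge0 // lerXn2r ?nnegrE //.
  - by rewrite mulr_ge0 ?cut2_ge0 // invr_ge0 ltW.
  - exact: le_trans (cut2_ge0 _ _ d0) (cut2_le_ramp_cut _ _ d0).
  - apply: le_trans (cut2_le_ramp_cut _ _ d0).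
    by rewrite ler_piMr // cut2_ge0.
by split; exact: key.
Qed.

(** By the minimal surface equation the divergence of g(u) grad u / W reduces to
    g'(u) |grad u|^2 / W. *)
Lemma graph_div_energy d a b p :
  (graph_div d a p).1 + (graph_div d a p).2 =
  (energy (graph_profile d a b) p).1 + (energy (graph_profile d a b) p).2.
Proof.
have [Op|Op] := pselect (Omega p); last by rewrite graph_divN // graph_energyN.
rewrite graph_divT // graph_energyT //=; have -> : dnormal2 p = - dnormal1 p.
  by apply/eqP; rewrite -addr_eq0 addrC; apply/eqP; exact: minimal_surface_dnormal.
rewrite /normal1 /normal2; move: (partial1 u p) (partial2 u p) (dnormal1 p) => w1 w2 n.
ring.
Qed.

(** This is W <= 1 + |grad u|^2 / W: the excess of the density over its cutoff is
    the divergence of the field truncated at the lower level. *)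
Lemma graph_density_le d a b p :
  density (graph_profile d a b) p <=
  zext Omega (fun q => ramp d b (u q) ^+ 2) p +
  ((graph_div d b p).1 + (graph_div d b p).2).
Proof.
rewrite (graph_div_energy d b b).
have [Op|Op] := pselect (Omega p); last first.
  by rewrite graph_densityN // graph_energyN // (zextN _ Op) !addr0.
rewrite graph_densityT // graph_energyT // (zextT _ Op) /=.
have A0 := area_gt0 u p; have A1 := area_ge1 u p.
have : partial1 u p ^+ 2 + partial2 u p ^+ 2 = area u p ^+ 2 - 1.
  by rewrite area_sqr addrAC subrr add0r.
move: (partial1 u p) (partial2 u p) => w1 w2 E; rewrite -mulrDl -mulrDr E.
rewrite -mulrA -[X in X + _]mulr1 -mulrDr ler_wpM2l ?sqr_ge0 //.
have : (area u p)^-1 <= 1 by rewrite invf_le1.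
have -> : (area u p ^+ 2 - 1) / area u p = area u p - (area u p)^-1.
  by field; exact: lt0r_neq0.
lra.
Qed.

Lemma graph_flow_bound d a p (k : R) : 0 < d -> 0 < a -> 0 <= k ->
  (Omega p -> u p <= k) ->
  `|(graph_flow d a p).1| <= k /\ `|(graph_flow d a p).2| <= k.
Proof.
move=> d0 a0 k0 uk; have [Op|Op] := pselect (Omega p); last first.
  by rewrite graph_flowN // normr0.
rewrite graph_flowT //.
have up0 : 0 <= u p by case: S => _ /(_ p Op).
have c2 : `|cut2 d a (u p)| <= k.
  rewrite ger0_norm ?cut2_ge0 //; apply: le_trans (uk Op).
  by apply: cut2_le => //; exact: ltW.
have key (w w' : R) : area u p ^+ 2 = 1 + (w ^+ 2 + w' ^+ 2) ->
    `|cut2 d a (u p) * ((area u p)^-1 * w)| <= k.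
  move=> E; rewrite normrM -[k]mulr1 ler_pM // mulrC.
  have A0 := area_gt0 u p.
  rewrite normrM normfV (gtr0_norm A0) ler_pdivrMr // mul1r.
  rewrite -ler_sqr ?nnegrE ?(ltW A0) // real_normK ?num_real // E.
  by have := sqr_ge0 w'; lra.
rewrite /normal1 /normal2; move: (area_sqr u p).
move: (partial1 u p) (partial2 u p) => w1 w2 E; split; first exact: key E.
by apply: (key _ w1); rewrite E [w1 ^+ 2 + _]addrC.
Qed.

Lemma height_constant P p p' : admissible P ->
  (forall q, slope P q = (0, 0)) -> height P p = height P p'.
Proof.
case: p p' => x y [x' y'] [_ dP _ _] s0; apply: (@etrans _ _ (height P (x', y))).
  apply: (@is_derive_0_is_cst _ (fun t => height P (t, y))) => t.
  have [d1 _] := dP (t, y); rewrite s0 in d1.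
  exact: (iffLR (is_derive_horizontal (height P) t y _) d1).
apply: (@is_derive_0_is_cst _ (fun t => height P (x', t))) => t.
have [_ d2] := dP (x', t); rewrite s0 in d2.
exact: (iffLR (is_derive_vertical (height P) x' t _) d2).
Qed.

(** The truncated height is positive somewhere in Omega and vanishes at p', so
    it has a nonzero partial derivative somewhere; the energy, which is the
    divergence of the field, is positive there. *)
Lemma graph_flux_gt0 p' : ~ Omega p' -> exists2 d, 0 < d &
  exists2 r0, 0 < r0 & forall r, r0 <= r -> 0 < flux (graph_flow d (d + d)) r.
Proof.
move=> Op'; case: S => _ upos [p Op up].
have {}up : 0 < u p by rewrite lt_neqAle eq_sym up upos.
(* The value u p = 4 d exceeds 3 d, and the height is positive from there on. *)
pose d := u p / 4; have d0 : 0 < d by rewrite divr_gt0.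
have dd0 : 0 < d + d by lra.
exists d => //; pose P := graph_profile d (d + d) d.
have aP : admissible P by exact: graph_admissible.
have [q sq] : exists q, slope P q <> (0, 0).
  apply: contrapT => /forallNP s0.
  have := @height_constant P p p' aP (fun q => contrapT (s0 q)).
  rewrite (graph_heightT d (d + d) d Op) (graph_heightN d (d + d) d Op').
  move=> /eqP; apply/negP.
  by rewrite lt0r_neq0 // cut_gt0 // /d; lra.
apply: (flux_gt0 (p0 := q) (graph_is_flow d0 dd0)) => [p0|].
  have [_ _ /(_ p0)[_ e1 e2] _] := aP.
  by rewrite (graph_div_energy d (d + d) d); exact: addr_ge0 e1 e2.
rewrite (graph_div_energy d (d + d) d); move: sq.
have [Oq|Oq] := pselect (Omega q); last by rewrite graph_slopeN.
rewrite graph_slopeT // graph_energyT //=; have A0 := area_gt0 u q.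
move: (partial1 u q) (partial2 u q) => w1 w2 sq.
have s1 : 0 <= (ramp d (d + d) (u q) * w1) ^+ 2 by exact: sqr_ge0.
have s2 : 0 <= (ramp d (d + d) (u q) * w2) ^+ 2 by exact: sqr_ge0.
rewrite -mulrDl -!exprMn divr_gt0 // lt_neqAle addr_ge0 // andbT eq_sym.
apply: contra_notN sq; rewrite paddr_eq0 // !sqrf_eq0.
by move=> /andP[/eqP -> /eqP ->].
Qed.

End truncated_graph.

(** * Sublinear growth and the main theorem *)

Section growth_rate.
Context {R : realType}.

Lemma sublinear_bound (Omega : set (R * R)) (u : R * R -> R) (e : R) : 0 < e ->
  sublinear_growth Omega u ->
  exists M, forall p, 0 < enorm p -> M < enorm p -> Omega p -> u p <= e * enorm p.
Proof.
move=> e0 /(_ _ (nbhsx_ballx _ e e0)) [M _ HM].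
exists M => p p0 Mp Op; have := HM p Mp Op.
rewrite /= /ball /= sub0r normrN ltr_norml => /andP[_].
by rewrite ltr_pdivrMr // => /ltW.
Qed.

Lemma flux_gt0_support (V D : R * R -> R * R) (r : R) : 0 <= r -> is_flow V D ->
  0 < flux V r -> exists2 p, on_loop r p & V p <> (0, 0).
Proof.
move=> r0 VD; apply: contraPP => /forall2NP V0; apply/negP; rewrite -leNgt.
apply: le_trans (ler_norm _) _; rewrite -(mulr0 (8 * r)).
apply: (flux_bound r0 VD) => p lp; have [//|/contrapT ->] := V0 p.
by rewrite normr0.
Qed.

End growth_rate.

Theorem corollary1p2 (R : realType) (k : nat)
  (Omega : 'I_k -> set (R * R)) (u : 'I_k -> R * R -> R)
  (hk : (1 <= k)%N)
  (hG : disjointly_supported Omega u)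
  (hgrowth : forall i : 'I_k, sublinear_growth (Omega i) (u i)) :
  (k <= 2)%N.
Proof.
rewrite leqNgt; apply/negP => k3.
pose O (i : 'I_3) := Omega (widen_ord k3 i).
pose v (i : 'I_3) := u (widen_ord k3 i).
have [hGS htriv] := hG.
have G i : minimal_graph (O i) (v i) by case: (hGS (widen_ord k3 i)).
have S i : supported (O i) (v i) by case: (hGS (widen_ord k3 i)).
have disj i j p : i != j -> O i p -> O j p -> False.
  move=> /eqP ij Oi Oj; apply: ij; apply/val_inj => /=.
  have := htriv (widen_ord k3 i) (widen_ord k3 j) I I.
  by move=> /(_ (ex_intro _ p (conj Oi Oj))) [].
have other (i : 'I_3) : exists j, j != i.
  have [->|i0] := eqVneq i ord0; first by exists (lift ord0 ord0).
  by exists ord0; rewrite eq_sym.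
(* Truncation at level 2 d defines the growing flux, at level d the density. *)
have /choice [d Hd] : forall i, exists d, 0 < d /\ exists2 r0, 0 < r0 &
    forall r, r0 <= r -> 0 < flux (graph_flow (O i) (v i) d (d + d)) r.
  move=> i; have [j ji] := other i; case: (S j) => _ _ [p Op _].
  have [d d0 dr] := graph_flux_gt0 (G i) (S i) (fun Oi => disj j i p ji Op Oi).
  by exists d.
have d0 i : 0 < d i by case: (Hd i).
have dd0 i : 0 < d i + d i by rewrite addr_gt0.
have /choice [r1 Hr1] : forall i, exists r0, 0 < r0 /\
    forall r, r0 <= r -> 0 < flux (graph_flow (O i) (v i) (d i) (d i + d i)) r.
  by move=> i; have [_ [r0 r00 H]] := Hd i; exists r0.
(* A point p of the boundary of the square has enorm p <= 2 r, so 1/480 yields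
   u <= r / 240 there, each flux is at most r^2 / 30, and the three fluxes at
   the lower level add up to at most r^2 / 10. *)
have e0 : 0 < 1 / 480 :> R by lra.
have /choice [M HM] := fun i => sublinear_bound e0 (hgrowth (widen_ord k3 i)).
pose r0 := 1 + \sum_i (`|r1 i| + `|M i|).
have r0_ge1 : 1 <= r0 by rewrite lerDl sumr_ge0.
have r0_gt i : `|r1 i| + `|M i| < r0.
  by rewrite /r0 (bigD1 i) //= addrCA ltrDl ltr_pwDl // sumr_ge0.
have vle i r p : r0 <= r -> on_loop r p -> O i p -> v i p <= r / 240.
  move=> rr0 lp Op; have rpos : 0 <= r by lra.
  have /andP[h1 h2] := on_loop_enorm rpos lp.
  have := HM i p _ _ Op; have := r0_gt i; have := ler_norm (M i).
  have := normr_ge0 (r1 i) => n1 n2 n3 H.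
  by apply: le_trans (H _ _) _; lra.
have flow i : is_flow (graph_flow (O i) (v i) (d i) (d i + d i))
    (graph_div (O i) (v i) (d i) (d i + d i)) by exact: graph_is_flow.
have flow' i : is_flow (graph_flow (O i) (v i) (d i) (d i))
    (graph_div (O i) (v i) (d i) (d i)) by exact: graph_is_flow.
have adm i : admissible (graph_profile (O i) (v i) (d i) (d i + d i) (d i)).
  exact: graph_admissible.
have fbound i a r : r0 <= r -> 0 < a ->
    is_flow (graph_flow (O i) (v i) (d i) a) (graph_div (O i) (v i) (d i) a) ->
    flux (graph_flow (O i) (v i) (d i) a) r <= r ^+ 2 / 30.
  move=> rr0 a0 fl; have rpos : 0 <= r by lra.
  have k0 : 0 <= r / 240 by lra.
  apply: le_trans (ler_norm _) _.
  apply: (@le_trans _ _ (8 * r * (r / 240))); last by lra.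
  apply: (flux_bound rpos fl) => p lp; apply: graph_flow_bound => // Op.
  exact: vle.
have fpos i r : r0 <= r -> 0 < flux (graph_flow (O i) (v i) (d i) (d i + d i)) r.
  move=> rr0; case: (Hr1 i) => _; apply.
  have := r0_gt i; have := ler_norm (r1 i); have := normr_ge0 (M i); lra.
apply: (@no_three_growing R
  (fun i => flux (graph_flow (O i) (v i) (d i) (d i + d i)))
  (fun i => loop (fun p => (graph_div (O i) (v i) (d i) (d i + d i) p).1 +
                           (graph_div (O i) (v i) (d i) (d i + d i) p).2))
  (fun i => loop (density (graph_profile (O i) (v i) (d i) (d i + d i) (d i))))
  (fun r => \sum_i flux (graph_flow (O i) (v i) (d i) (d i)) r)
  (fun r => \sum_i loop (fun p => (graph_div (O i) (v i) (d i) (d i) p).1 +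
                           (graph_div (O i) (v i) (d i) (d i) p).2) r) r0).
- lra.
- by move=> i r rr0; apply: flux_is_derive => //; lra.
- move=> i r rr0; rewrite fpos //=.
  by apply: le_trans (fbound _ _ _ rr0 (dd0 i) (flow i)) _; nra.
- move=> i r rr0; have rpos : 0 <= r by lra.
  have <- : @loop R (fun=> 0) r = 0 by rewrite loop_cst ?mulr0.
  have [[_ cm _] _ P0 _] := adm i.
  apply: le_loop => //; first exact: cst_continuous.
  by move=> p; case: (P0 p).
- move=> i r rr0; have rpos : 0 < r by lra.
  have [j ji] := other i.
  apply: (flux_growth rpos (adm i) (flow i)).
  + exact: graph_controlled.
  + by move=> p; exact: graph_div_energy.
  + have [p lp Vp] := flux_gt0_support (ltW rpos) (flow j) (fpos j r rr0).
    (* The height of graph i vanishes where another graph carries flux. *)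
    exists p => //; apply: graph_heightN => Oi; apply: Vp.
    apply: graph_flowN => Oj; exact: (disj j i p).
- move=> r rr0; have rpos : 0 < r by lra.
  have := @is_derive_sum _ _ _ 3
    (fun i s => flux (graph_flow (O i) (v i) (d i) (d i)) s) r 1 _
    (fun i : 'I_3 => flux_is_derive rpos (flow' i)).
  have -> // : \sum_(i < 3) (fun s => flux (graph_flow (O i) (v i) (d i) (d i)) s) =
     (fun s => \sum_i flux (graph_flow (O i) (v i) (d i) (d i)) s).
  by apply/funext => s; rewrite fct_sumE.
- move=> r rr0; apply: (@le_trans _ _ (\sum_(i < 3) (r ^+ 2 / 30))).
    by apply: ler_sum => i _; exact: fbound.
  by rewrite !big_ord_recl big_ord0; lra.
- move=> r rr0; have rpos : 0 <= r by lra.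
  pose chi i := zext (O i) (fun q => ramp (d i) (d i) (v i q) ^+ 2).
  have cchi i : continuous (chi i) by exact: continuous_graph_cutoff.
  have cdiv i : continuous (fun p => (graph_div (O i) (v i) (d i) (d i) p).1 +
                           (graph_div (O i) (v i) (d i) (d i) p).2).
    have [_ cD _ _] := flow' i.
    by apply: continuous_add; [exact: continuous_fst|exact: continuous_snd].
  apply: (@le_trans _ _ (\sum_i (loop (chi i) r +
      loop (fun p => (graph_div (O i) (v i) (d i) (d i) p).1 +
                     (graph_div (O i) (v i) (d i) (d i) p).2) r))).
    apply: ler_sum => i _; rewrite -loopD //.
    have [[_ cm _] _ _ _] := adm i.
    apply: le_loop => //; first exact: continuous_add.
    by move=> p; exact: graph_density_le.
  rewrite big_split /= lerD2r -[8 * r]mulr1 -loop_cst //.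
  rewrite !big_ord_recl big_ord0 addr0 -!loopD //; last exact: continuous_add.
  apply: le_loop => //; [|exact: cst_continuous|].
    by apply: continuous_add => //; exact: continuous_add.
  (* By disjointness at most one of the three cutoffs is nonzero at p. *)
  move=> p; have chi1 i : chi i p <= 1.
    rewrite /chi; have [Op|Op] := pselect (O i p); last by rewrite zextN.
    by rewrite zextT //; have /andP[? ?] := ramp01 (d i) (d i) (v i p); rewrite expr_le1.
  have chiN i j : i != j -> O i p -> chi j p = 0.
    by move=> ij Oi; rewrite /chi zextN // => Oj; exact: (disj i j p).
  pose i1 : 'I_3 := lift ord0 ord0; pose i2 : 'I_3 := lift ord0 (lift ord0 ord0).
  rewrite -/i1 -/i2.
  have [p0|p0] := pselect (O ord0 p).
    by rewrite (chiN ord0 i1) // (chiN ord0 i2) // !addr0.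
  rewrite {1}/chi zextN // add0r; have [p1|p1] := pselect (O i1 p).
    by rewrite (chiN i1 i2) // addr0.
  by rewrite {1}/chi zextN // add0r.
Qed.
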